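(* Let $G$ be a finite group and $n\ge0$. There are commutative diagrams \[\begin{array}{ccccc}A(G)&\xrightarrow{\ \mathbb{P}_n\ }&\mathring{A}(G,n)&\longrightarrow&A(G\wr\Sigma_n)\\ {\scriptstyle\chi}\downarrow&&{\scriptstyle\chi}\downarrow&&\downarrow{\scriptstyle\chi}\\ \mathrm{Marks}(G)&\xrightarrow{\ \mathbb{P}_n\ }&\mathrm{Parks}(G,n)&\xrightarrow{\ \beta^*\ }&\mathrm{Marks}(G\wr\Sigma_n)\end{array}\] where the unlabelled map is the inclusion and the lower map $\mathbb{P}_n\colon\mathrm{Marks}(G)\to\mathrm{Parks}(G,n)$ is $\mathbb{P}_n(f)(\lambda)=\prod_{[H],m}f([H])^{\lambda_{[H],m}}$. In particular, for $f\in\mathrm{Marks}(G)$ the image of $f$ in $\mathrm{Marks}(G\wr\Sigma_n)$ under the bottom composite, also denoted $\mathbb{P}_n(f)$, is given by \[\mathbb{P}_n(f)([H])=\prod_{[K],m}f([K])^{\beta([H])_{[K],m}}=\prod_{Hi\in H\backslash[n]}f([H_{ii}])\] for $[H]\in\mathrm{Conj}(G\wr\Sigma_n)$.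
   Context: For a finite group $\Gamma$, $A(\Gamma)$ is the Burnside ring, with canonical $\mathbb{Z}$-basis the isomorphism classes of transitive $\Gamma$-sets; $\mathrm{Conj}(\Gamma)$ is the set of conjugacy classes of subgroups; $\mathrm{Marks}(\Gamma)=\mathrm{Fun}(\mathrm{Conj}(\Gamma),\mathbb{Z})$; the marks homomorphism $\chi\colon A(\Gamma)\to\mathrm{Marks}(\Gamma)$ is $\chi([X])([H])=|X^H|$. $G\wr\Sigma_n=G^{\times n}\rtimes\Sigma_n$ with $(\bar g,\sigma)(\bar h,\tau)=(\bar g\,\sigma\bar h,\sigma\tau)$, $(\sigma\bar h)_i=\bar h_{\sigma^{-1}(i)}$; for a left $G$-set $X$ it acts on $X^{\times n}$ by $((\bar g,\sigma)x)_i=\bar g_ix_{\sigma^{-1}(i)}$. The transfer product $\star\colon A(G\wr\Sigma_i)\otimes A(G\wr\Sigma_j)\to A(G\wr\Sigma_{i+j})$ is $X\star Y=(G\wr\Sigma_{i+j})\times_{G\wr\Sigma_i\times G\wr\Sigma_j}(X\times Y)$. The total power operations $\mathbb{P}_n\colon A(G)\to A(G\wr\Sigma_n)$ are the unique functions with $\mathbb{P}_n([X])=[X^{\times n}]$, $\mathbb{P}_0=1$ and $\mathbb{P}_n(x+y)=\sum_{i+j=n}\mathbb{P}_i(x)\star\mathbb{P}_j(y)$. $\mathring{A}(G,n)\subseteq A(G\wr\Sigma_n)$ is the summand spanned by the smallest subset of the canonical basis whose span contains the image of $\mathbb{P}_n$. $\mathring{A}(G)=\bigoplus_{n\ge0}\mathring{A}(G,n)$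 is a commutative graded ring under $\star$, in fact a polynomial ring on the generators $\mathbb{P}_n([G/H])$ in degree $n$, for $n>0$ and $[H]\in\mathrm{Conj}(G)$. $\mathrm{Parts}(G)$ is the free commutative monoid on $\mathrm{Conj}(G)\times\mathbb{N}_{>0}$, whose elements are finitely supported functions $\lambda\colon\mathrm{Conj}(G)\times\mathbb{N}_{>0}\to\mathbb{N}$, written $\lambda=\sum\lambda_{[H],m}\cdot([H],m)$; $\|\lambda\|=\sum\lambda_{[H],m}m$, $\lambda!=\prod\lambda_{[H],m}!$, $\mathrm{Parts}(G,n)=\{\lambda:\|\lambda\|=n\}$. $\mathrm{Parks}(G,n)=\mathrm{Fun}(\mathrm{Parts}(G,n),\mathbb{Z})$, and $\mathrm{Parks}(G)=\bigoplus_n\mathrm{Parks}(G,n)$ is a commutative graded ring under $(f\star g)(\mu)=\sum_{\kappa+\lambda=\mu}\frac{\mu!}{\kappa!\lambda!}f(\kappa)g(\lambda)$. The parks homomorphism $\chi\colon\mathring{A}(G)\to\mathrm{Parks}(G)$ is the unique homomorphism of graded rings (for the $\star$-products) whose value on the polynomial generators is $\chi(\mathbb{P}_n([G/H]))(\lambda)=\prod_{[K],m}\chi([G/H])([K])^{\lambda_{[K],m}}$, for $\lambda\in\mathrm{Parts}(G,n)$. For a subgroup $H\subseteq G\wr\Sigma_n$, let $H$ act on $[n]=\{1,\dots,n\}$ through $G\wr\Sigma_n\to\Sigma_n$, let $H\backslash[n]$ be the set of orbits $Hi$, and let $H_{ii}=\{\bar g_i\mid(\bar g,\sigma)\in H,\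 \sigma(i)=i\}\subseteq G$. Then $\beta([H])=\sum_{Hi\in H\backslash[n]}([H_{ii}],|Hi|)\in\mathrm{Parts}(G,n)$, and $\beta^*f([H])=f(\beta([H]))$. *)

(* Defs.v *)
From HB Require Import structures.
From mathcomp Require Import all_boot all_order all_algebra all_fingroup.
From mathcomp Require Import finmap multiset.
From mathcomp Require Import boolp.

Set Implicit Arguments.
Unset Strict Implicit.
Unset Printing Implicit Defensive.
Import GRing.Theory.
Local Open Scope group_scope.
Local Open Scope fset_scope.
Local Open Scope mset_scope.
Local Open Scope ring_scope.

Record gset (gT : finGroupType) := GSet {
  gset_sort :> finType;
  lact : gT -> gset_sort -> gset_sort;
  lact1 : forall x, lact 1%g x = x;
  lactM : forall a b x, lact (a * b)%g x = lact a (lact b x) }.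
Arguments GSet {gT gset_sort lact}.

(* MathComp actions are right actions; a left action is turned into one by  *)
(* inversion.  Orbits and stabilisers are unaffected.                       *)
Section RightAction.
Variables (gT : finGroupType) (X : gset gT).
Definition gset_act_fun (x : X) (a : gT) : X := lact a^-1%g x.
Fact gset_act_fun1 x : gset_act_fun x 1%g = x.
Proof. by rewrite /gset_act_fun invg1 lact1. Qed.
Fact gset_act_funM x : act_morph gset_act_fun x.
Proof. by move=> a b; rewrite /gset_act_fun invMg lactM. Qed.
Definition gset_act : {action gT &-> X} := TotalAction gset_act_fun1 gset_act_funM.
End RightAction.

Definition gfix (gT : finGroupType) (X : gset gT) (H : {set gT}) : {set X} :=
  [set x | [forall a in H, lact a x == x]].

Definition gset_iso (gT : finGroupType) (X Y : gset gT) : Prop :=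
  exists2 f : X -> Y, bijective f & forall a x, f (lact a x) = lact a (f x).

Section Point.
Variable gT : finGroupType.
Definition point_gset : gset gT :=
  @GSet gT unit (fun _ x => x) (fun=> erefl) (fun _ _ _ => erefl).
End Point.

Section CosetSet.
Variables (gT : finGroupType) (H : {set gT}).
Definition lcoset_sort := {A : {set gT} | A \in lcosets H [set: gT]}.
Fact lcoset_act_subproof (a : gT) (A : lcoset_sort) :
  lcoset (val A) a \in lcosets H [set: gT].
Proof.
case: A => A /= /lcosetsP[b _ ->]; apply/lcosetsP; exists (a * b)%g => //.
by rewrite !lcosetE lcosetM.
Qed.
Definition lcoset_act (a : gT) (A : lcoset_sort) : lcoset_sort :=
  Sub (lcoset (val A) a) (lcoset_act_subproof a A).
Fact lcoset_act1 A : lcoset_act 1%g A = A.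
Proof. by apply: val_inj; rewrite /= lcosetE mul1g. Qed.
Fact lcoset_actM a b A :
  lcoset_act (a * b)%g A = lcoset_act a (lcoset_act b A).
Proof. by apply: val_inj; rewrite /= !lcosetE lcosetM. Qed.
(* G/H *)
Definition coset_gset : gset gT := GSet lcoset_act1 lcoset_actM.
End CosetSet.

Section ProductSet.
Variables (gT1 gT2 : finGroupType) (X : gset gT1) (Y : gset gT2).
Definition prod_act (a : gT1 * gT2) (p : X * Y) : X * Y :=
  (lact a.1 p.1, lact a.2 p.2).
Fact prod_act1 p : prod_act 1%g p = p.
Proof. by case: p => x y; rewrite /prod_act !lact1. Qed.
Fact prod_actM a b p : prod_act (a * b)%g p = prod_act a (prod_act b p).
Proof. by rewrite /prod_act !lactM. Qed.
Definition prod_gset : gset (gT1 * gT2)%type := GSet prod_act1 prod_actM.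
End ProductSet.

(* The balanced product L x_K Z along phi : K -> L.  Its elements are the   *)
(* classes of (l phi(k), z) ~ (l, k z), i.e. the sets of all                 *)
(* (l phi(k)^-1, k z) for a fixed (l, z).                                    *)
Section Balanced.
Variables (kT lT : finGroupType) (phi : {morphism [set: kT] >-> lT}).
Variable Z : gset kT.
Definition balanced_class (p : lT * Z) : {set lT * Z} :=
  [set ((p.1 * (phi k)^-1)%g, lact k p.2) | k : kT].
Definition balanced_sort :=
  {C : {set lT * Z} | C \in [set balanced_class p | p : lT * Z]}.
Definition balanced_act_set (a : lT) (C : {set lT * Z}) : {set lT * Z} :=
  [set ((a * p.1)%g, p.2) | p in C].
Fact balanced_act_subproof (a : lT) (C : balanced_sort) :
  balanced_act_set a (val C) \in [set balanced_class p | p : lT * Z].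
Proof.
case: C => C /= /imsetP[[l z] _ ->]; apply/imsetP; exists ((a * l)%g, z) => //.
rewrite /balanced_act_set /balanced_class -imset_comp; apply: eq_imset => k /=.
by rewrite mulgA.
Qed.
Definition balanced_act (a : lT) (C : balanced_sort) : balanced_sort :=
  Sub (balanced_act_set a (val C)) (balanced_act_subproof a C).
Fact balanced_act1 C : balanced_act 1%g C = C.
Proof.
apply: val_inj => /=; rewrite /balanced_act_set -[RHS]imset_id.
by apply: eq_imset => -[l z] /=; rewrite mul1g.
Qed.
Fact balanced_actM a b C :
  balanced_act (a * b)%g C = balanced_act a (balanced_act b C).
Proof.
apply: val_inj => /=; rewrite /balanced_act_set -imset_comp.
by apply: eq_imset => -[l z] /=; rewrite mulgA.
Qed.
Definition balanced_gset : gset lT := GSet balanced_act1 balanced_actM.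
End Balanced.

Section Transversal.
Variables (aT : finGroupType) (T : finType) (to : {action aT &-> T}).
Variable G : {group aT}.
Local Notation X := (orbit_transversal to G [set: T]).

Lemma orbit_transversal_inj x y :
  x \in X -> y \in X -> y \in orbit to G x -> x = y.
Proof.
have [|_ _ inj _] := @orbit_transversalP _ _ _ to G [set: T].
  by apply/subsetP=> a _; rewrite !inE; apply/subsetP=> z _; rewrite !inE.
by move=> xX yX; rewrite inj // => /eqP.
Qed.

Lemma orbit_transversal_ex x : exists2 y, y \in X & y \in orbit to G x.
Proof.
have [|_ _ _ ex] := @orbit_transversalP _ _ _ to G [set: T].
  by apply/subsetP=> a _; rewrite !inE; apply/subsetP=> z _; rewrite !inE.
by have [//|a aG aX] := ex x; exists (to x a) => //; apply: mem_orbit.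
Qed.

Lemma sum_orbit_transversal (R : Type) (idx : R) (op : Monoid.com_law idx)
    (F : T -> R) :
  \big[op/idx]_(x in X) \big[op/idx]_(y in orbit to G x) F y =
    \big[op/idx]_y F y.
Proof.
pose rep y := odflt y [pick x in X | x \in orbit to G y].
have repP y : rep y \in X /\ rep y \in orbit to G y.
  rewrite /rep; case: pickP => [x /andP[]//|no].
  by have [x xX xy] := orbit_transversal_ex y; move: (no x); rewrite xX xy.
rewrite [RHS](partition_big rep (mem X)) => [|y _]; last by case: (repP y).
apply: eq_bigr => x xX; apply: eq_bigl => y /=; have [rX ry] := repP y.
apply/idP/eqP => [yx|<-]; last by rewrite orbit_sym.
by apply/esym/orbit_transversal_inj => //; apply: orbit_trans ry yx.
Qed.
End Transversal.

Section Conj.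
Variable gT : finGroupType.
Definition conj_classes : {set {set {set gT}}} :=
  [set (H :^: [set: gT])%g | H : {group gT}].
Definition Conj := {c : {set {set gT}} | c \in conj_classes}.
Fact conj_of_subproof (H : {group gT}) : (H :^: [set: gT])%g \in conj_classes.
Proof. by apply/imsetP; exists H. Qed.
Definition conj_of (H : {group gT}) : Conj :=
  Sub (H :^: [set: gT])%g (conj_of_subproof H).
Definition conj_repr (c : Conj) : {group gT} :=
  odflt 1%G [pick H : {group gT} | conj_of H == c].
Lemma conj_reprK : cancel conj_repr conj_of.
Proof.
move=> c; rewrite /conj_repr; case: pickP => [H /eqP //|noH].
case/imsetP: (valP c) => H _ defc; exfalso.
by move: (noH H); rewrite -val_eqE /= defc eqxx.
Qed.
Lemma conj_ofP (H K : {group gT}) :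
  reflect (exists a, K :=: H :^ a)%g (conj_of H == conj_of K).
Proof.
rewrite -val_eqE /=; apply: (iffP eqP) => [E|[a ->]].
  have : (K : {set gT}) \in (K :^: [set: gT])%g.
    by apply/imsetP; exists 1%g; rewrite ?inE ?conjsg1.
  by rewrite -E => /imsetP[a _ ->]; exists a.
apply/setP=> A; apply/imsetP/imsetP => -[b _ ->].
  by exists (a^-1 * b)%g; rewrite ?inE // -conjsgM mulKVg.
by exists (a * b)%g; rewrite ?inE // conjsgM.
Qed.
End Conj.

(* The additive group of the Burnside ring: the free abelian group on the   *)
(* isomorphism classes of transitive G-sets.  The class of G/H is indexed   *)
(* by [H].                                                                  *)
Definition burnside (gT : finGroupType) := {ffun Conj gT -> int}.

Definition Marks (gT : finGroupType) := {ffun Conj gT -> int}.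

Definition basis (gT : finGroupType) (c : Conj gT) : burnside gT :=
  [ffun d => (d == c)%:R].

(* [X], by decomposing X into orbits *)
Definition gclass (gT : finGroupType) (X : gset gT) : burnside gT :=
  \sum_(x in orbit_transversal (gset_act X) [set: gT] [set: X])
    basis (conj_of ('C[x | gset_act X])%G).

(* The additive extension of [G/K] |-> (H |-> |(G/K)^H|); see marks_gclass.  *)
Definition marks (gT : finGroupType) (x : burnside gT) : Marks gT :=
  [ffun c => \sum_d x d *
     #|gfix (coset_gset (conj_repr d)) (conj_repr c)|%:R].

Record wr (gT : finGroupType) (n : nat) :=
  Wr { wbase : {ffun 'I_n -> gT}; wperm : 'S_n }.
Arguments Wr {gT n}.

Section Wreath.
Variables (gT : finGroupType) (n : nat).
Notation W := (wr gT n).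
Definition wr_pair (w : W) := (wbase w, wperm w).
Definition pair_wr (p : {ffun 'I_n -> gT} * 'S_n) : W := Wr p.1 p.2.
Fact wr_pairK : cancel wr_pair pair_wr. Proof. by case. Qed.
HB.instance Definition _ := Finite.copy W (can_type wr_pairK).

(* In MathComp (s * t) i = t (s i), so the composite sigma tau, which applies *)
(* tau first, is wperm v * wperm u.                                          *)
Definition wr_mul (u v : W) : W :=
  Wr [ffun i => (wbase u i * wbase v ((wperm u)^-1 i))%g]
     (wperm v * wperm u)%g.
Definition wr_one : W := Wr [ffun=> 1%g] 1%g.
Definition wr_inv (u : W) : W :=
  Wr [ffun i => (wbase u (wperm u i))^-1%g] (wperm u)^-1%g.
Fact wr_mulA : associative wr_mul.
Proof.
move=> u v w; congr Wr; rewrite /= ?mulgA //.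
by apply/ffunP=> i; rewrite !ffunE invMg permM mulgA.
Qed.
Fact wr_mul1 : left_id wr_one wr_mul.
Proof.
case=> g s; congr Wr; rewrite /= ?mulg1 //.
by apply/ffunP=> i; rewrite !ffunE mul1g invg1 perm1.
Qed.
Fact wr_mulV : left_inverse wr_one wr_inv wr_mul.
Proof.
case=> g s; congr Wr; rewrite /= ?mulgV //.
by apply/ffunP=> i; rewrite !ffunE /= invgK mulVg.
Qed.
HB.instance Definition _ := Finite_isGroup.Build W wr_mulA wr_mul1 wr_mulV.

Lemma wbaseM (u v : W) i :
  wbase (u * v)%g i = (wbase u i * wbase v ((wperm u)^-1 i))%g.
Proof. by rewrite ffunE. Qed.
Lemma wpermM (u v : W) : wperm (u * v)%g = (wperm v * wperm u)%g.
Proof. by []. Qed.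
Lemma wbase1 i : wbase (1 : W)%g i = 1%g. Proof. by rewrite ffunE. Qed.
Lemma wperm1 : wperm (1 : W)%g = 1%g. Proof. by []. Qed.
Lemma wbaseV (u : W) i : wbase u^-1%g i = (wbase u (wperm u i))^-1%g.
Proof. by rewrite ffunE. Qed.
Lemma wpermV (u : W) : wperm u^-1%g = (wperm u)^-1%g. Proof. by []. Qed.

Variable X : gset gT.
Definition pow_act (w : W) (x : {ffun 'I_n -> X}) : {ffun 'I_n -> X} :=
  [ffun i => lact (wbase w i) (x ((wperm w)^-1%g i))].
Fact pow_act1 x : pow_act 1%g x = x.
Proof.
by apply/ffunP=> i; rewrite !ffunE lact1 invg1 perm1.
Qed.
Fact pow_actM u v x : pow_act (u * v)%g x = pow_act u (pow_act v x).
Proof. by apply/ffunP=> i; rewrite !ffunE lactM invMg permM. Qed.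
Definition pow_gset : gset (wr gT n) := GSet pow_act1 pow_actM.
End Wreath.
Arguments pow_gset {gT} n X.

(* The block inclusion of G wr S_i x G wr S_j into G wr S_n, n = i + j       *)
Section Block.
Variables (gT : finGroupType) (i j n : nat) (e : (i + j)%N = n).
Definition block_split (k : 'I_n) : 'I_i + 'I_j :=
  split (cast_ord (esym e) k).
Definition block_join (s : 'I_i + 'I_j) : 'I_n := cast_ord e (unsplit s).
Fact block_splitK : cancel block_split block_join.
Proof.
by move=> k; rewrite /block_join /block_split splitK cast_ordKV.
Qed.
Fact block_joinK : cancel block_join block_split.
Proof. by move=> s; rewrite /block_join /block_split cast_ordK unsplitK. Qed.
Definition block_perm_fun (s : 'S_i) (t : 'S_j) (k : 'I_n) : 'I_n :=
  block_join match block_split k with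
             | inl a => inl (s a)
             | inr b => inr (t b)
             end.
Fact block_perm_inj s t : injective (block_perm_fun s t).
Proof.
move=> k l /(can_inj block_joinK) E; apply: (can_inj block_splitK).
by move: E; case: block_split => a; case: block_split => b // [] /perm_inj ->.
Qed.
Definition block_perm s t : 'S_n := perm (@block_perm_inj s t).
Definition block_wr (p : wr gT i * wr gT j) : wr gT n :=
  Wr [ffun k => match block_split k with
                | inl a => wbase p.1 a
                | inr b => wbase p.2 b
                end]
     (block_perm (wperm p.1) (wperm p.2)).
Lemma block_permV s t : ((block_perm s t)^-1 = block_perm s^-1 t^-1)%g.
Proof.
apply/eqP; rewrite eq_invg_mul; apply/eqP/permP=> k.
rewrite permM perm1 !permE /block_perm_fun; case E: (block_split k) => [a|b];
  by rewrite block_joinK permK -E block_splitK.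
Qed.
Fact block_wrM : {in [set: wr gT i * wr gT j] &, {morph block_wr : u v / u * v}}%g.
Proof.
move=> u v _ _; congr Wr.
  apply/ffunP=> k; rewrite !ffunE /= block_permV permE /block_perm_fun.
  by case E: (block_split k) => [a|b]; rewrite block_joinK !ffunE.
apply/permP=> k; rewrite permM !permE /block_perm_fun.
by case: (block_split k) => a; rewrite block_joinK permM.
Qed.
Definition block_morphism : {morphism [set: wr gT i * wr gT j] >-> wr gT n} :=
  Morphism block_wrM.

Definition transfer_gset (X : gset (wr gT i)) (Y : gset (wr gT j)) :
  gset (wr gT n) := balanced_gset block_morphism (prod_gset X Y).

(* The biadditive extension of ([X], [Y]) |-> [transfer_gset X Y]             *)
Definition star (x : burnside (wr gT i)) (y : burnside (wr gT j)) :
    burnside (wr gT n) :=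
  \sum_c \sum_d
    gclass (transfer_gset (coset_gset (conj_repr c)) (coset_gset (conj_repr d)))
      *~ (x c * y d).
End Block.

(* The properties that characterise the family P_n, n >= 0.                  *)
Definition total_power_operations (gT : finGroupType)
    (P : forall n, burnside gT -> burnside (wr gT n)) : Prop :=
  [/\ forall n (X : gset gT), P n (gclass X) = gclass (pow_gset n X),
      forall x, P 0%N x = gclass (point_gset (wr gT 0%N))
    & forall n (x y : burnside gT), P n (x + y) =
        \sum_(i < n.+1) star (subnKC (leq_ord i)) (P i x) (P (n - i)%N y)].

Definition in_span (lT : finGroupType) (S : {set Conj lT}) (x : burnside lT) :
    Prop :=
  exists a : Conj lT -> int, x = \sum_(c in S) basis c *~ a c.

Lemma in_spanP (lT : finGroupType) (S : {set Conj lT}) (x : burnside lT) :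
  in_span S x <-> forall c, c \notin S -> x c = 0.
Proof.
have sumE (a : Conj lT -> int) c :
    (\sum_(d in S) basis d *~ a d : burnside lT) c = if c \in S then a c else 0.
  rewrite sum_ffunE.
  transitivity (\sum_(d in S) if d == c then a d else 0).
    apply: eq_bigr => d _; rewrite ffunMzE ffunE eq_sym.
    by case: eqP; rewrite ?mul0rz // mulr1n intz.
  case: ifPn => cS; rewrite -big_mkcondr.
    by rewrite (big_pred1 c) // => d /=; case: eqP => [->|]; rewrite ?cS ?andbF.
  by rewrite big1 // => d /andP[dS /eqP E]; rewrite -E dS in cS.
split=> [[a ->] c cS|x0]; first by rewrite sumE (negPf cS).
by exists x; apply/ffunP=> c; rewrite sumE; case: ifPn => // /x0 ->.
Qed.
Section Summand.
Variables (gT : finGroupType).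
Variables (P : forall n, burnside gT -> burnside (wr gT n)) (n : nat).

(* The smallest subset of the canonical basis whose span contains the image  *)
(* of P n                                                                    *)
Definition power_basis : {set Conj (wr gT n)} :=
  \bigcap_(S : {set Conj (wr gT n)} | `[< forall x, in_span S (P n x) >]) S.

Definition Aring_pred : {pred burnside (wr gT n)} :=
  fun x => `[< in_span power_basis x >].

Fact Aring_zmod_closed : zmod_closed Aring_pred.
Proof.
split=> [|x y]; first by apply/asboolP/in_spanP => c _; rewrite ffunE.
move=> /asboolP/in_spanP x0 /asboolP/in_spanP y0; apply/asboolP/in_spanP => c cS.
by rewrite !ffunE x0 ?y0 ?subr0.
Qed.
HB.instance Definition _ := GRing.isZmodClosed.Build _ Aring_pred Aring_zmod_closed.

Definition Aring := {x : burnside (wr gT n) | x \in Aring_pred}.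
HB.instance Definition _ := SubChoice.on Aring.
HB.instance Definition _ := [SubChoice_isSubZmodule of Aring by <:].

Fact Aring_power_subproof x : P n x \in Aring_pred.
Proof.
apply/asboolP/in_spanP=> c /bigcapP cS; apply/eqP; apply: contra_notT cS => Pc.
move=> S /asboolP/(_ x)/in_spanP PS; apply: contraR Pc => /PS ->.
exact: eqxx.
Qed.
(* P n with codomain restricted to the summand *)
Definition Aring_power (x : burnside gT) : Aring :=
  Sub (P n x) (Aring_power_subproof x).

End Summand.

Definition pos_nat := {m : nat | (0 < m)%N}.

Definition Parts (gT : finGroupType) := {mset Conj gT * pos_nat}.

Definition parts_norm (gT : finGroupType) (l : Parts gT) : nat :=
  (\sum_(k <- finsupp l) l k * val k.2)%N.

Definition parts_fact (gT : finGroupType) (l : Parts gT) : nat :=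
  (\prod_(k <- finsupp l) (l k)`!)%N.

HB.instance Definition _ (K : choiceType) :=
  Monoid.isComLaw.Build {mset K} mset0 msetD (@msetDA K) (@msetDC K) (@mset0D K).

Section PartsTheory.
Variable gT : finGroupType.
Implicit Types l m : Parts gT.

Lemma parts_normE l : parts_norm l = (\sum_(k <- enum_mset l) val k.2)%N.
Proof. by rewrite sum_mset. Qed.
Lemma parts_norm0 : parts_norm (mset0 : Parts gT) = 0%N.
Proof. by rewrite parts_normE big_mset0. Qed.
Lemma parts_normD l m : parts_norm (l `+` m) = (parts_norm l + parts_norm m)%N.
Proof.
rewrite !parts_normE -big_cat; apply: perm_big; rewrite /perm_eq.
by apply/allP=> k _ /=; rewrite count_cat !count_mem_mset msetE2.
Qed.
Lemma parts_norm1 k : parts_norm ([mset k] : Parts gT) = val k.2.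
Proof. by rewrite parts_normE big_msetn. Qed.
End PartsTheory.

Record Parts_n (gT : finGroupType) (n : nat) :=
  PartsN { parts_val :> Parts gT; parts_valP : parts_norm parts_val == n }.

Section PartsFinite.
Variables (gT : finGroupType) (n : nat).

Definition parts_code (l : Parts_n gT n) : {ffun Conj gT * 'I_n -> 'I_n.+1} :=
  [ffun p => inord (parts_val l (p.1, Sub (val p.2).+1 (ltn0Sn _)))].
Definition parts_decode (f : {ffun Conj gT * 'I_n -> 'I_n.+1}) :
    option (Parts_n gT n) :=
  let l : Parts gT := \big[msetD/mset0]_p
    msetn (f p) (p.1, Sub (val p.2).+1 (ltn0Sn _)) in
  if @idP (parts_norm l == n) is ReflectT h then Some (PartsN h) else None.

Fact parts_codeK : pcancel parts_code parts_decode.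
Proof.
case=> l lP; rewrite /parts_decode; set l' : Parts gT := \big[_/_]_p _.
have El : l' = l.
  have bound k : k \in finsupp l -> (l k * val k.2 <= n)%N.
    move=> kl; rewrite -(eqP lP) /parts_norm (big_fsetD1 k) //=.
    exact: leq_addr.
  have sumE k : l' k = (\sum_(p : Conj gT * 'I_n)
      if k == (p.1, Sub (val p.2).+1 (ltn0Sn _)) then
        val (parts_code (PartsN lP) p) else 0)%N.
    rewrite /l'; elim/big_rec2: _ => [|p m m' _ <-]; first by rewrite mset0E.
    by rewrite msetE2 msetnE.
  apply/msetP=> -[c [[//|m] m_gt0]]; rewrite sumE.
  have [m_lt|m_ge] := ltnP m n; last first.
    rewrite big1 => [|[c' i] _]; last first.
      case: eqP => // -[_ E]; move: m_ge; rewrite leqNgt E.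
      by rewrite ltn_ord.
    apply/esym/eqP; apply: contraLR m_ge; rewrite -ltnNge => lk.
    have /bound/= : (c, exist _ m.+1 m_gt0) \in finsupp l by rewrite mem_finsupp.
    by apply: leq_trans; rewrite leq_pmull // lt0n.
  rewrite (bigD1 (c, Ordinal m_lt)) //= big1 => [|[c' i]].
    rewrite addn0 ffunE /=; set k := (c, _); set k' := (c, _).
    have -> : k' = k by congr pair; apply: val_inj.
    rewrite eqxx inordK // ltnS; case: (boolP (k \in finsupp l)) => [|kl].
      by move/bound; apply: leq_trans; rewrite leq_pmulr.
    by rewrite fsfun_dflt.
  move=> ne; have [[Ec Em]|//] := (_, _) =P (_, _).
  by case/eqP: ne; rewrite Ec; congr pair; apply/val_inj/esym.
case: {-}_ / idP => [h|]; last by rewrite El lP.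
by congr Some; move: h; rewrite El => h; congr PartsN; apply: bool_irrelevance.
Qed.
HB.instance Definition _ := Finite.copy (Parts_n gT n) (pcan_type parts_codeK).
End PartsFinite.

Definition Parks (gT : finGroupType) (n : nat) := {ffun Parts_n gT n -> int}.

Section ParksRing.
Variable gT : finGroupType.
Definition parks_one : Parks gT 0%N := [ffun=> 1].

(* Meant for n = i + j; the natural number quotient is exact whenever        *)
(* kappa + lambda = mu.                                                      *)
Definition parks_star (i j n : nat) (f : Parks gT i) (g : Parks gT j) :
    Parks gT n :=
  [ffun mu : Parts_n gT n =>
    \sum_(kappa : Parts_n gT i) \sum_(lambda : Parts_n gT j
        | parts_val kappa `+` parts_val lambda == parts_val mu)
      (parts_fact mu %/ (parts_fact kappa * parts_fact lambda))%:R
        * f kappa * g lambda].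

Definition parts_eval (f : Marks gT) (l : Parts gT) : int :=
  \prod_(k <- finsupp l) f k.1 ^+ l k.

Definition marks_power (n : nat) (f : Marks gT) : Parks gT n :=
  [ffun l : Parts_n gT n => parts_eval f l].
End ParksRing.
Arguments parks_star {gT i j n}.
Arguments marks_power {gT} n f.

(* The properties that characterise the parks homomorphism.  The graded ring *)
(* homomorphism is given by its components chi n.  The products star e x y   *)
(* lie in the summand, so every pair x, y is covered by some z below.        *)
Definition parks_homomorphism (gT : finGroupType)
    (P : forall n, burnside gT -> burnside (wr gT n))
    (chi : forall n, {additive Aring P n -> Parks gT n}) : Prop :=
  [/\ forall z : Aring P 0%N,
        val z = gclass (point_gset (wr gT 0%N)) -> chi 0%N z = parks_one gT,
      forall i j n (e : (i + j)%N = n)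
             (x : Aring P i) (y : Aring P j) (z : Aring P n),
        val z = star e (val x) (val y) -> chi n z = parks_star (chi i x) (chi j y)
    & forall n (H : {group gT}), (0 < n)%N -> forall l : Parts_n gT n,
        chi n (Aring_power P n (gclass (coset_gset H))) l =
          parts_eval (marks (gclass (coset_gset H))) l].

Section Beta.
Variables (gT : finGroupType) (n : nat).

(* [n] as a right G wr S_n-set, by the same convention as gset_act.          *)
Definition wr_idx_fun (i : 'I_n) (w : wr gT n) : 'I_n := (wperm w)^-1%g i.
Fact wr_idx_fun1 i : wr_idx_fun i 1%g = i.
Proof. by rewrite /wr_idx_fun invg1 perm1. Qed.
Fact wr_idx_funM i : act_morph wr_idx_fun i.
Proof. by move=> a b; rewrite /wr_idx_fun wpermM invMg permM. Qed.
Definition wr_idx : {action wr gT n &-> 'I_n} :=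
  TotalAction wr_idx_fun1 wr_idx_funM.

Section Isotropy.
Variables (H : {group wr gT n}) (i : 'I_n).
(* H_ii *)
Definition isotropy : {set gT} :=
  [set wbase w i | w in H & wperm w i == i].
Fact isotropy_group_set : group_set isotropy.
Proof.
apply/group_setP; split.
  by apply/imsetP; exists 1%g; rewrite ?inE ?group1 ?perm1 ?eqxx ?wbase1.
move=> _ _ /imsetP[u /setIdP[uH /eqP ui] ->] /imsetP[v /setIdP[vH /eqP vi] ->].
apply/imsetP; exists (u * v)%g.
  by rewrite inE groupM //= permM vi ui eqxx.
by rewrite wbaseM; congr (_ * wbase v _)%g; rewrite -[LHS](permK (wperm u)) ui.
Qed.
Canonical isotropy_group := Group isotropy_group_set.

Fact orbit_card_gt0 : (0 < #|orbit wr_idx H i|)%N.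
Proof. by apply/card_gt0P; exists i; apply: orbit_refl. Qed.
Definition orbit_size : pos_nat := Sub #|orbit wr_idx H i| orbit_card_gt0.
End Isotropy.

Definition beta_parts (H : {group wr gT n}) : Parts gT :=
  \big[msetD/mset0]_(i in orbit_transversal wr_idx H [set: 'I_n])
    [mset (conj_of (isotropy_group H i), orbit_size H i)].

Fact beta_norm (H : {group wr gT n}) : parts_norm (beta_parts H) == n.
Proof.
rewrite /beta_parts (big_morph _ (@parts_normD gT) (@parts_norm0 gT)).
under eq_bigr do rewrite parts_norm1 /= -sum1_card.
by rewrite sum_orbit_transversal sum1_card card_ord.
Qed.
Definition beta (H : {group wr gT n}) : Parts_n gT n := PartsN (beta_norm H).

Definition beta_star (f : Parks gT n) : Marks (wr gT n) :=
  [ffun c => f (beta (conj_repr c))].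
End Beta.

(* With the lemmas below, the definitions through representatives agree with *)
(* the usual ones: [G/H] is the basis element of [H], the marks of [X] count *)
(* fixed points, the star product of [X] and [Y] is the class of the         *)
(* balanced product, and beta only depends on the conjugacy class.           *)

Definition orbit_reps (aT : finGroupType) (T : finType) (to : {action aT &-> T})
   (G : {set aT}) (X : {set T}) : Prop :=
  {in X &, forall x y, y \in orbit to G x -> x = y} /\
  forall x, exists2 y, y \in X & y \in orbit to G x.

Lemma transversal_reps (aT : finGroupType) (T : finType) (to : {action aT &-> T})
   (G : {group aT}) : orbit_reps to G (orbit_transversal to G [set: T]).
Proof.
split; [exact: orbit_transversal_inj | exact: orbit_transversal_ex].
Qed.

Section BigReps.
Variables (aT aT' : finGroupType) (T T' : finType).
Variables (to : {action aT &-> T}) (to' : {action aT' &-> T'}).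
Variables (G : {group aT}) (G' : {group aT'}) (X : {set T}) (X' : {set T'}).
Variables (phi : T -> T') (R : Type) (idx : R) (op : Monoid.com_law idx).
Lemma big_orbit_reps (F : T -> R) (F' : T' -> R) :
  orbit_reps to G X -> orbit_reps to' G' X' ->
  (forall x y, (phi y \in orbit to' G' (phi x)) = (y \in orbit to G x)) ->
  (forall y', exists x, phi x \in orbit to' G' y') ->
  (forall x, F x = F' (phi x)) ->
  (forall x' y', y' \in orbit to' G' x' -> F' y' = F' x') ->
  \big[op/idx]_(x in X) F x = \big[op/idx]_(x in X') F' x.
Proof.
move=> [Xinj Xex] [Xinj' Xex'] orbE surj FE F'E.
pose psi x := odflt (phi x) [pick y in X' | y \in orbit to' G' (phi x)].
have psiP x : psi x \in X' /\ psi x \in orbit to' G' (phi x).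
  rewrite /psi; case: pickP => [y /andP[]//|no].
  by have [y yX yx] := Xex' (phi x); move: (no y); rewrite yX yx.
have -> : \big[op/idx]_(x in X) F x = \big[op/idx]_(x in X) F' (psi x).
  by apply: eq_bigr => x _; rewrite FE; apply/esym/F'E; case: (psiP x).
rewrite -(big_imset (h := psi)) => [|x y xX yX E].
  apply: eq_bigl => y'; apply/imsetP/idP => [[x _ ->]|y'X]; first by case: (psiP x).
  have [x xy'] := surj y'; have [z zX zx] := Xex x; exists z => //.
  apply: Xinj' => //; first by case: (psiP z).
  have [_ pz] := psiP z; apply: orbit_trans pz _.
  by apply: orbit_trans xy'; rewrite orbE.
apply: Xinj => //; rewrite -orbE.
have [_ px] := psiP x; have [_ py] := psiP y.
by rewrite E in px; apply: orbit_trans px; rewrite orbit_sym.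
Qed.
End BigReps.

Section Gset.
Variables (gT : finGroupType).
Lemma orbit_gsetP (X : gset gT) (x y : X) :
  reflect (exists a, lact a x = y) (y \in orbit (gset_act X) [set: gT] x).
Proof.
apply: (iffP orbitP) => [[a _ <-]|[a <-]]; first by exists a^-1%g.
by exists a^-1%g; rewrite ?inE //= /gset_act_fun invgK.
Qed.
Lemma in_stab (X : gset gT) (x : X) a :
  (a \in 'C[x | gset_act X])%g = (lact a x == x).
Proof.
apply/astab1P/eqP => /= [E|E]; rewrite /gset_act_fun in E *.
  by rewrite -{1}E -lactM mulgV lact1.
by rewrite -{1}E -lactM mulVg lact1.
Qed.
Definition stab_class (X : gset gT) (x : X) := conj_of ('C[x | gset_act X])%G.
Lemma stab_class_orbit (X : gset gT) (x y : X) :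
  y \in orbit (gset_act X) [set: gT] x -> stab_class y = stab_class x.
Proof.
case/orbitP=> a _ <-; apply/eqP; rewrite eq_sym; apply/conj_ofP; exists a.
by apply: astab1_act; rewrite inE.
Qed.
Lemma stab_classE (X : gset gT) (x : X) (K : {group gT}) :
  (forall a, (lact a x == x) = (a \in K)) -> stab_class x = conj_of K.
Proof.
move=> E; congr conj_of; apply/val_inj/setP=> a.
by apply: etrans (E a); apply: in_stab.
Qed.
Lemma sum_stab_class (V : zmodType) (X : gset gT) (B : Conj gT -> V) :
  \sum_(x in orbit_transversal (gset_act X) [set: gT] [set: X]) B (stab_class x)
   = \sum_c B c *~ gclass X c.
Proof.
under [RHS]eq_bigr => c _ do rewrite sum_ffunE mulrz_sumr.
rewrite exchange_big; apply: eq_bigr => x _.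
rewrite (bigD1 (stab_class x)) //= big1 => [|c ne]; rewrite ffunE.
  by rewrite eqxx addr0.
by rewrite -/(stab_class x) (negPf ne).
Qed.
Lemma gclass_reps (X : gset gT) (S : {set X}) :
  orbit_reps (gset_act X) [set: gT] S -> gclass X = \sum_(x in S) basis (stab_class x).
Proof.
move=> SP; apply: (big_orbit_reps (phi := id) _ (transversal_reps _ _) SP) => //.
  by move=> x; exists x; apply: orbit_refl.
by move=> x y /stab_class_orbit ->.
Qed.
Lemma gclass_iso (X Y : gset gT) : gset_iso X Y -> gclass X = gclass Y.
Proof.
case=> f [g fK gK] fM.
apply: (big_orbit_reps (phi := f) _ (transversal_reps _ _) (transversal_reps _ _)).
- move=> x y; apply/orbit_gsetP/orbit_gsetP => -[a E]; exists a.
    by apply: (can_inj fK); rewrite fM.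
  by rewrite -fM E.
- by move=> y; exists (g y); rewrite gK orbit_refl.
- move=> x; congr basis; apply: stab_classE => a.
  by rewrite in_stab -fM (inj_eq (can_inj fK)).
by move=> x y /stab_class_orbit; rewrite /stab_class => ->.
Qed.


Lemma gclass_coset (H : {group gT}) : gclass (coset_gset H) = basis (conj_of H).
Proof.
have ptP : (H : {set gT}) \in lcosets H [set: gT].
  by apply/lcosetsP; exists 1%g; rewrite ?inE // mul1g.
pose pt : coset_gset H := Sub (H : {set gT}) ptP.
rewrite (@gclass_reps _ [set pt]) ?big_set1.
  congr basis; apply: stab_classE => a; rewrite -val_eqE /= lcosetE.
  apply/eqP/idP => [<-|aH]; last exact: lcoset_id.
  exact: lcoset_refl.
split=> [x y /set1P -> /set1P -> //|A]; exists pt; first exact: set11.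
rewrite orbit_sym; apply/orbit_gsetP; have /lcosetsP[a _ E] := valP A.
by exists a; apply: val_inj; rewrite /= E lcosetE.
Qed.
End Gset.
Lemma gclass_balanced (kT lT : finGroupType)
    (phi : {morphism [set: kT] >-> lT}) (Z : gset kT) (S : {set Z}) :
  orbit_reps (gset_act Z) [set: kT] S ->
  gclass (balanced_gset phi Z) =
    \sum_(z in S) basis (conj_of (phi @* 'C[z | gset_act Z])%G).
Proof.
move=> SP; pose pt (z : Z) : balanced_gset phi Z :=
  Sub (balanced_class phi (1%g, z)) (imset_f _ isT).
have phiM a b : phi (a * b)%g = (phi a * phi b)%g by rewrite morphM ?inE.
have phiV a : phi a^-1%g = (phi a)^-1%g by rewrite morphV ?inE.
have ptE l z z' : lact l (pt z) = pt z' -> exists2 k, l = phi k & lact k z = z'.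
  move/(congr1 val) => /= E.
  have : (1%g, z') \in balanced_class phi (1%g, z').
    by apply/imsetP; exists 1%g; rewrite ?inE //= morph1 invg1 mulg1 lact1.
  rewrite -E => /imsetP[_ /imsetP[k _ ->] /= [E1 E2]]; exists k; last by rewrite E2.
  by move/eqP: E1; rewrite mul1g eq_sym -eq_mulgV1 => /eqP.
have ptE' k z : lact (phi k) (pt z) = pt (lact k z).
  apply: val_inj => /=; apply/setP=> p; apply/imsetP/imsetP.
    case=> _ /imsetP[b _ ->] ->; exists (b * k^-1)%g; rewrite ?inE //=.
    by rewrite -lactM mulgKV phiM phiV invMg invgK !mul1g.
  case=> b _ -> /=; exists ((phi (b * k)%g)^-1%g, lact (b * k)%g z) => /=.
    by apply/imsetP; exists (b * k)%g; rewrite ?inE //= mul1g.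
  by rewrite phiM invMg mulKVg mul1g lactM.
apply/esym.
apply: (big_orbit_reps (phi := pt) _ SP (transversal_reps _ _)).
- move=> x y; apply/orbit_gsetP/orbit_gsetP => [[l /ptE[k _ <-]]|[k <-]].
    by exists k.
  by exists (phi k).
- move=> C; have /imsetP[[l z] _ E] := valP C; exists z.
  rewrite orbit_sym; apply/orbit_gsetP; exists l; apply: val_inj.
  rewrite E /= /balanced_act_set /balanced_class -imset_comp.
  by apply: eq_imset => k /=; rewrite mul1g.
- move=> z; congr basis; apply/esym/stab_classE => l.
  apply/eqP/imsetP => [/ptE[k -> kz]|[k]].
    by exists k => //; rewrite inE in_stab kz eqxx inE.
  by rewrite inE in_stab /= => /andP[_ /eqP kz] ->; apply: etrans (ptE' _ _) _; rewrite kz.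
by move=> x y /stab_class_orbit; rewrite /stab_class => ->.
Qed.

Section Star.
Variables (gT : finGroupType) (i j n : nat) (e : (i + j)%N = n).
Lemma orbit_reps_prod (gT1 gT2 : finGroupType) (X : gset gT1) (Y : gset gT2)
  (S : {set X}) (S' : {set Y}) :
  orbit_reps (gset_act X) [set: gT1] S -> orbit_reps (gset_act Y) [set: gT2] S' ->
  orbit_reps (gset_act (prod_gset X Y)) [set: gT1 * gT2] (setX S S').
Proof.
case=> Si Se [Si' Se']; split=> [[x y] [x' y']|[x y]] /=.
  rewrite !inE /= => /andP[xS yS] /andP[xS' yS'] /(@orbit_gsetP _ (prod_gset X Y))[[a b]] [].
  move=> ax yb; rewrite -ax -yb in xS' yS' *; congr pair.
    by apply: Si => //; apply/(@orbit_gsetP _ X); exists a.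
  by apply: Si' => //; apply/(@orbit_gsetP _ Y); exists b.
have [x' xS /orbit_gsetP[a ax]] := Se x; have [y' yS /orbit_gsetP[b bx]] := Se' y.
exists (x', y'); first by rewrite !inE xS.
apply/(@orbit_gsetP _ (prod_gset X Y)); exists (a, b).
by rewrite /= /prod_act /= ax bx.
Qed.
Lemma conj_of_setX (H H' : {group wr gT i}) (K K' : {group wr gT j}) :
  conj_of H = conj_of H' -> conj_of K = conj_of K' ->
  conj_of (block_morphism gT e @* setX H K)%G =
  conj_of (block_morphism gT e @* setX H' K')%G.
Proof.
move=> /eqP/conj_ofP[a EH] /eqP/conj_ofP[b EK]; apply/eqP/conj_ofP.
exists (block_morphism gT e (a, b)); rewrite -morphimJ ?inE //=; congr (_ @* _)%g.
apply/setP=> -[u v]; rewrite mem_conjg !inE /= EH EK !mem_conjg.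
by [].
Qed.
Lemma gclass_transfer X Y :
  gclass (transfer_gset e X Y) = 
  \sum_(x in orbit_transversal (gset_act X) [set: wr gT i] [set: X])
  \sum_(y in orbit_transversal (gset_act Y) [set: wr gT j] [set: Y])
    basis (conj_of (block_morphism gT e @* setX 'C[x | gset_act X] 'C[y | gset_act Y])%G).
Proof.
rewrite (gclass_balanced _ (orbit_reps_prod (transversal_reps _ _) (transversal_reps _ _))).
rewrite pair_big; apply: eq_big => -[x y] /=; first by rewrite inE.
move=> _; congr (basis (conj_of _)); apply/val_inj; congr (_ @* _)%g.
apply/setP=> -[u v]; rewrite in_setX.
by rewrite (@in_stab _ (prod_gset X Y)) !in_stab.
Qed.
Lemma star_gclass (X : gset (wr gT i)) (Y : gset (wr gT j)) :
  star e (gclass X) (gclass Y) = gclass (transfer_gset e X Y).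
Proof.
pose B c d : burnside (wr gT n) :=
  basis (conj_of (block_morphism gT e @* setX (conj_repr c) (conj_repr d))%G).
have transE (X' : gset (wr gT i)) (Y' : gset (wr gT j)) : gclass (transfer_gset e X' Y') =
    \sum_c \sum_d B c d *~ (gclass X' c * gclass Y' d).
  rewrite gclass_transfer.
  transitivity (\sum_c (\sum_d B c d *~ gclass Y' d) *~ gclass X' c); last first.
    apply: eq_bigr => c _; rewrite mulrz_suml; apply: eq_bigr => d _.
    by rewrite mulrC mulrzA.
  transitivity (\sum_c (\sum_(y in orbit_transversal (gset_act Y')
      [set: wr gT j] [set: Y']) B c (stab_class y)) *~ gclass X' c); last first.
    by apply: eq_bigr => c _; rewrite sum_stab_class.
  rewrite -(@sum_stab_class _ _ _ (fun c => \sum_(y in _) B c (stab_class y))).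
  apply: eq_bigr => x _; apply: eq_bigr => y _; congr basis.
  by apply: conj_of_setX; rewrite conj_reprK.
rewrite transE; apply: eq_bigr => c _; apply: eq_bigr => d _; congr (_ *~ _).
rewrite transE !gclass_coset !conj_reprK (bigD1 c) //= [X in _ + X]big1 => [|c' ne].
  rewrite addr0 (bigD1 d) //= [X in _ + X]big1 => [|d' ne].
    by rewrite addr0 !ffunE !eqxx mulr1.
  by rewrite !ffunE (negPf ne) mulr0.
by rewrite big1 // => d' _; rewrite !ffunE (negPf ne) mul0r.
Qed.
End Star.

Section Marks.
Variable gT : finGroupType.
Definition transporter_card (H K : {set gT}) : nat := #|[set a | H :^ a \subset K]%g|.
Lemma card_gfix_orbit (X : gset gT) (x : X) (H : {group gT}) :
  (#|[set y in gfix X H | y \in orbit (gset_act X) [set: gT] x]| *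
    #|'C[x | gset_act X]%g|)%N = transporter_card H 'C[x | gset_act X]%g.
Proof.
set O := [set y in _ | _]; pose f a := lact a x.
have fP a : (f a \in O) = (H :^ a \subset 'C[x | gset_act X])%g.
  rewrite inE; have -> : f a \in orbit (gset_act X) [set: gT] x.
    by apply/orbit_gsetP; exists a.
  rewrite andbT inE; apply/forall_inP/subsetP => [fx _ /imsetP[h hH ->]|sub h hH].
    rewrite in_stab /conjg !lactM (eqP (fx h hH)) /f -lactM mulVg lact1 eqxx //.
  have : (h ^ a)%g \in ('C[x | gset_act X])%g by apply/sub/imset_f.
  rewrite in_stab /conjg !lactM => /eqP/(congr1 (lact a)) E.
  by rewrite -lactM mulgV lact1 in E; rewrite /f E.
rewrite /transporter_card -sum_nat_const -[RHS]sum1_card [RHS](partition_big f (mem O)) => [|a].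
  apply: eq_bigr => y yO; have /setIdP[_ /orbit_gsetP[b bx]] := yO.
  rewrite sum1_card -(card_lcoset _ b); apply: eq_card => a.
  rewrite mem_lcoset in_stab unfold_in /= inE -fP lactM; apply/eqP/andP => [E|[_ /eqP E]].
    have fa : f a = y by rewrite -bx -[in RHS]E -lactM mulgV lact1.
    by rewrite fa yO.
  by rewrite -/(f a) E -bx -lactM mulVg lact1.
by rewrite inE -fP.
Qed.
Lemma transporter_cardJ (H K : {set gT}) a b :
  transporter_card (H :^ a)%g (K :^ b)%g = transporter_card H K.
Proof.
pose h y := (a^-1 * y * b)%g.
have hI : injective h by apply: (inj_comp (mulIg b) (mulgI a^-1%g)).
rewrite -[RHS](card_imset _ hI); apply: eq_card => x; rewrite inE.
apply/idP/imsetP => [sub|[y ysub ->]].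
  exists (a * x * b^-1)%g; last by rewrite /h !mulgA mulgKV mulVg mul1g.
  by rewrite inE !conjsgM sub_conjgV.
by rewrite inE in ysub; rewrite /h -conjsgM !mulgA mulgV mul1g conjsgM conjSg.
Qed.
Lemma card_gfix_coset (K H : {group gT}) :
  (#|gfix (coset_gset K) H| * #|K|)%N = transporter_card H K.
Proof.
have ptP : (K : {set gT}) \in lcosets K [set: gT].
  by apply/lcosetsP; exists 1%g; rewrite ?inE // mul1g.
pose pt : coset_gset K := Sub (K : {set gT}) ptP.
have stE : 'C[pt | gset_act (coset_gset K)]%g = K.
  apply/setP=> a; rewrite in_stab -val_eqE /= lcosetE.
  by apply/eqP/idP => [<-|aH]; [apply: lcoset_refl|apply: lcoset_id].
have := card_gfix_orbit pt H; rewrite stE => <-; congr (_ * _)%N.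
apply: eq_card => A; rewrite !inE andbC.
suff -> : A \in orbit (gset_act (coset_gset K)) [set: gT] pt by [].
apply/orbit_gsetP; have /lcosetsP[a _ E] := valP A.
by exists a; apply: val_inj; rewrite /= E lcosetE.
Qed.
Lemma marks_gclass (X : gset gT) (H : {group gT}) :
  marks (gclass X) (conj_of H) = #|gfix X H|%:R.
Proof.
rewrite ffunE.
pose N d : int := #|gfix (coset_gset (conj_repr d)) (conj_repr (conj_of H))|%:R.
transitivity (\sum_d N d *~ gclass X d).
  by apply: eq_bigr => d _; rewrite -mulrzr intz mulrC.
have sumE (A : {set X}) : #|A|%:R = \sum_y (y \in A)%:R :> int.
  by rewrite -sum1_card natr_sum big_mkcond; apply: eq_bigr => y _; case: (y \in A).
rewrite -sum_stab_class sumE -(sum_orbit_transversal (gset_act X) [set: gT]%G).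
apply: eq_bigr => x _; transitivity (#|[set y in gfix X H |
    y \in orbit (gset_act X) [set: gT] x]|%:R : int); last first.
  rewrite sumE [RHS]big_mkcond; apply: eq_bigr => y _; rewrite inE.
  by case: (y \in orbit _ _ _); rewrite ?andbT ?andbF.
rewrite /N; congr (_%:R); set K := conj_repr _; set L := conj_repr _.
have /eqP/conj_ofP[a EK] : conj_of ('C[x | gset_act X])%G = conj_of K.
  by rewrite conj_reprK.
have /eqP/conj_ofP[b EL] : conj_of H = conj_of L by rewrite conj_reprK.
apply/eqP; rewrite -(eqn_pmul2r (cardG_gt0 K)) card_gfix_coset EK EL.
by rewrite transporter_cardJ -card_gfix_orbit cardJg.
Qed.
End Marks.

Section BetaConj.
Variables (gT : finGroupType) (n : nat).
Local Notation to := (wr_idx gT n).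
Lemma isotropyJ (H : {group wr gT n}) a i :
  isotropy (H :^ a)%g (to i a) = (isotropy H i :^ wbase a i)%g.
Proof.
have sub (K : {group wr gT n}) b k : (isotropy K k :^ wbase b k \subset isotropy (K :^ b)%G (to k b))%g.
  apply/subsetP=> _ /imsetP[_ /imsetP[h /setIdP[hK /eqP hk] ->] ->].
  apply/imsetP; exists (h ^ b)%g.
    rewrite inE memJ_conjg hK /= /wr_idx_fun !permM permKV hk.
    by rewrite eqxx.
  rewrite /conjg !wbaseM wbaseV wpermV invgK /= /wr_idx_fun permKV.
  have hk' : ((wperm h)^-1)%g k = k by rewrite -{1}hk permK.
  by rewrite hk'.
apply/eqP; rewrite eqEsubset sub andbT.
have := sub (H :^ a)%G a^-1%g (to i a).
rewrite wbaseV /= /wr_idx_fun permKV wpermV invgK permKV.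
rewrite sub_conjgV.
by rewrite {2}/isotropy /= conjsgK.
Qed.
Lemma beta_conj (H K : {group wr gT n}) : conj_of H = conj_of K -> beta H = beta K.
Proof.
move=> /eqP/conj_ofP[a EK].
have {EK} -> : K = (H :^ a)%G by apply: val_inj.
suff E : beta_parts H = beta_parts (H :^ a)%G.
  rewrite /beta; move: (beta_norm H) (beta_norm (H :^ a)%G); rewrite E => p q.
  by congr PartsN; apply: bool_irrelevance.
have cls (L : {group wr gT n}) b k : 
   (conj_of (isotropy_group (L :^ b)%G (to k b)), orbit_size (L :^ b)%G (to k b)) =
   (conj_of (isotropy_group L k), orbit_size L k).
  congr pair.
    apply/eqP; rewrite eq_sym; apply/conj_ofP; exists (wbase b k).
    exact: isotropyJ.
  apply: val_inj => /=; rewrite -[RHS](card_imset _ (act_inj to b)); apply: eq_card => x.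
  rewrite -[x](actKV to b) orbit_conjsg; apply/idP/imsetP => [xk|[y yk /act_inj ->//]].
  by exists (to x b^-1%g).
have clsG (L : {group wr gT n}) k l : l \in orbit to L k ->
   (conj_of (isotropy_group L l), orbit_size L l) =
   (conj_of (isotropy_group L k), orbit_size L k).
  case/orbitP=> b bL <-; rewrite -[RHS](cls _ b).
  by have -> : (L :^ b)%G = L by apply/val_inj/conjGid.
apply: (@big_orbit_reps _ _ _ _ to to H (H :^ a)%G _ _ (to^~ a) _ _ _ _ _ (transversal_reps _ _) (transversal_reps _ _)).
- by move=> x y; rewrite orbit_conjsg.
- by move=> y; exists (to y a^-1%g); rewrite actKV orbit_refl.
- by move=> x; congr msetn; rewrite cls.
by move=> x y /clsG ->.
Qed.
End BetaConj.

(* Main.v *)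
Require Import Defs.
From HB Require Import structures.
From mathcomp Require Import all_boot all_order all_algebra all_fingroup.
From mathcomp Require Import finmap multiset boolp zify.

(** Both squares reduce to two facts about marks: one about cartesian powers
    and one about transfer products.

    Powers ([marks_pow]).  A point of X^n fixed by H is determined by its
    coordinates at one index of each H-orbit, and the coordinate at i ranges
    over the points of X fixed by H_ii.  So the marks of [X^n] are the pullback
    along beta of the n-th power of the marks of [X].

    Transfer products ([beta_star_star]).  If f and g pull back along beta to the
    marks of x and y, then the star product of f and g pulls back to the marks of
    the star product of x and y.  The marks of the transfer product at H count the
    l in G wr S_n that conjugate H into the block subgroup
    G wr S_i x G wr S_j ([marks_star]).  Such an l is recorded, up to that
    subgroup, by the H-stable set A of size i which it carries to the first block,
    and the two blocks of H^l have the orbits of H inside and outside A.  An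
    H-stable set is a set of orbits of H, and the number of sets of orbits of type
    kappa with complement of type lambda is mu! / (kappa! lambda!), where mu is
    the type of all orbits ([count_parts_of], [parks_starE]).

    Left square.  The same count gives the addition formula for the power of a
    sum of marks ([marks_powerD]), so both composites of the left square satisfy
    the recursion that defines the total power operations.  They agree on the
    classes [G/K], hence on effective elements, and on all of A(G) by cancellation
    ([burnside_ind]): the last term of the formula for P_n(x + y) is P_n(x).

    Right square.  Here one needs to know that the summand is spanned by star
    products of powers of orbits.  The basis elements occurring in P_n of an
    effective element are exactly the classes of products of wreath products
    K_1 wr S_(n_1) x ... x K_r wr S_(n_r), that is, star products of the classes
    P_(n_k)([G/K_k]).  Since effective elements have powers with nonnegative
    coefficients, no cancellation can occur and these classes are closed under the
    star product ([power_orbit_star]); by the cancellation argument they also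
    contain the support of P_n(x) for virtual x ([power_support]), so they are the
    basis of the summand ([power_basisP]).  On each of them the right square
    commutes, by induction on the number of factors ([beta_star_chi_basis]). *)

Set Implicit Arguments.
Unset Strict Implicit.
Unset Printing Implicit Defensive.
Import GRing.Theory Num.Theory Order.TTheory.
Local Open Scope fset_scope.
Local Open Scope mset_scope.
Local Open Scope ring_scope.

(** * Multisets of orbit types and the product of parks *)

Section PartsCombinatorics.
Variable gT : finGroupType.
Implicit Types (l m : Parts gT) (f g : Marks gT).

Lemma parts_val_inj n : injective (@parts_val gT n).
Proof. by case=> l lP [m mP] /= E; subst m; congr PartsN; apply: bool_irrelevance. Qed.

Lemma parts_fact_gt0 l : (0 < parts_fact l)%N.
Proof. by apply: prodn_gt0 => k; apply: fact_gt0. Qed.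

Lemma parts_fact0 : parts_fact (mset0 : Parts gT) = 1%N.
Proof. by rewrite /parts_fact big1 // => k _; rewrite mset0E. Qed.

Lemma parts_fact_incl l (S : {fset Conj gT * pos_nat}) :
  (finsupp l `<=` S)%fset -> parts_fact l = (\prod_(k <- S) (l k)`!)%N.
Proof.
move=> lS; rewrite /parts_fact (big_fset_incl _ lS) //; last by move=> k _ /fsfun_dflt ->.
Qed.

(** Adding one copy of k multiplies the factorial by the new multiplicity; this
    is the whole arithmetic input of the counting below. *)
Lemma parts_fact1D k l : parts_fact (k +` l) = ((l k).+1 * parts_fact l)%N.
Proof.
have kS : k \in (k |` finsupp l)%fset by rewrite !inE eqxx.
rewrite (@parts_fact_incl (k +` l) ((k |` finsupp l)%fset)); last first.
  by apply/fsubsetP=> x; rewrite !inE !mem_finsupp mset1DE; case: (x == k).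
rewrite (@parts_fact_incl l ((k |` finsupp l)%fset)) ?fsubsetU1 //.
have prodE (h : Conj gT * pos_nat -> nat) :
    (\prod_(x <- k |` finsupp l) h x = h k * \prod_(x <- (k |` finsupp l) `\ k) h x)%fset%N.
  exact: big_fsetD1.
rewrite !prodE mset1DE eqxx add1n factS mulnA.
set P1 := (\prod_(x <- _) _)%N; set P2 := (\prod_(x <- _) _)%N.
suff -> : P1 = P2 by [].
apply: eq_big_seq => x; rewrite in_fsetD1 => /andP[xk _].
by rewrite mset1DE (negPf xk).
Qed.

Lemma parts_evalE f l : parts_eval f l = \prod_(k <- enum_mset l) f k.1.
Proof. by rewrite big_mset; apply: eq_bigr. Qed.

Lemma parts_evalD f l m : parts_eval f (l `+` m) = parts_eval f l * parts_eval f m.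
Proof.
rewrite !parts_evalE -big_cat; apply: perm_big; rewrite /perm_eq.
by apply/allP=> k _ /=; rewrite count_cat !count_mem_mset msetE2.
Qed.

Lemma parts_eval0 f : parts_eval f (mset0 : Parts gT) = 1.
Proof. by rewrite parts_evalE big_mset0. Qed.

Lemma parts_eval1 f k : parts_eval f [mset k] = f k.1.
Proof. by rewrite parts_evalE big_msetn /=. Qed.

Section Types.
Variables (T : finType) (ty : T -> Conj gT * pos_nat).
Implicit Types (J D : {set T}).

Definition parts_of J : Parts gT := \big[msetD/mset0]_(t in J) [mset ty t].

Lemma parts_ofU1 t J : t \notin J -> parts_of (t |: J) = ty t +` parts_of J.
Proof. by move=> tJ; rewrite /parts_of big_setU1. Qed.

Lemma parts_ofD J D : J \subset D -> parts_of J `+` parts_of (D :\: J) = parts_of D.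
Proof.
move=> JD; rewrite /parts_of [RHS](big_setID J) /=.
by rewrite (setIidPr JD).
Qed.

Lemma parts_eval_parts_of f J : parts_eval f (parts_of J) = \prod_(t in J) f (ty t).1.
Proof.
rewrite /parts_of (big_morph _ (parts_evalD f) (parts_eval0 f)).
by apply: eq_bigr => t _; rewrite parts_eval1.
Qed.

Lemma parts_norm_parts_of J : parts_norm (parts_of J) = (\sum_(t in J) val (ty t).2)%N.
Proof.
rewrite /parts_of (big_morph _ (@parts_normD gT) (@parts_norm0 gT)).
by apply: eq_bigr => t _; rewrite parts_norm1.
Qed.

Lemma parts_ofE J k : parts_of J k = (\sum_(t in J) (ty t == k))%N.
Proof.
rewrite /parts_of; elim/big_rec2: _ => [|t a b _ <-]; first by rewrite mset0E.
by rewrite mset1DE eq_sym.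
Qed.

Lemma sum_subsetU1 t D (R : Type) (idx : R)
    (op : Monoid.com_law idx) (F : {set T} -> R) : t \notin D ->
  \big[op/idx]_(J : {set T} | J \subset t |: D) F J =
  \big[op/idx]_(J : {set T} | J \subset D) op (F (t |: J)) (F J).
Proof.
move=> tD; rewrite (bigID (fun J => t \in J)) big_split /=; congr (op _ _).
  rewrite (reindex_onto (fun J => t |: J) (fun J => J :\ t)) /=.
    apply: eq_bigl => J; rewrite setU11 andbT.
    apply/andP/idP => [[sJ /eqP <-]|JD].
      by rewrite subDset.
    split; first exact: setUS.
    by apply/eqP/setU1K/(contra _ tD)/(subsetP JD).
  by move=> J /andP[_ tJ]; rewrite setD1K.
apply: eq_bigl => J; apply/andP/idP => [[sJ tJ]|JD].
  apply/subsetP => x xJ; have := subsetP sJ x xJ; rewrite !inE.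
  by case/orP=> // /eqP E; rewrite -E xJ in tJ.
split; first exact: subset_trans JD (subsetUr _ _).
by apply: contra tD; apply: (subsetP JD).
Qed.

(** The half of Pascal's rule in which the new element, of type c, goes to the
    first of the two parts: by k! = k_c (k - c)! the count is weighted by the
    multiplicity of c in k.  When c does not occur in k both sides vanish. *)
Lemma count_pairs_step (I : finType) (Q : pred I) (p q : I -> Parts gT) m c :
  (forall k l : Parts gT, (\sum_(J | Q J) ((p J == k) && (q J == l))) *
     (parts_fact k * parts_fact l) = (k `+` l == m) * parts_fact m)%N ->
  forall k l : Parts gT, ((\sum_(J | Q J) ((c +` p J == k) && (q J == l))) *
     (parts_fact k * parts_fact l) = k c * ((k `+` l == c +` m) * parts_fact m))%N.
Proof.
have addI : injective (msetD [mset c] : Parts gT -> Parts gT).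
  by apply: (@can_inj _ _ _ (fun m' => m' `\ c)) => m'; apply: msetD1K.
move=> IH k l; have [ck|ck] := boolP (c \in k); last first.
  rewrite (mset_eq0P ck) mul0n big1 // => J _.
  case: eqP => // E; move: ck; rewrite -E.
  by rewrite in_mset1D eqxx.
rewrite -(msetB1K ck) -msetDA (inj_eq addI) parts_fact1D mset1DE eqxx.
rewrite -[(_.+1 * _ * _)%N]mulnA mulnCA -IH.
by congr (_ * (_ * _))%N; apply: eq_bigr => J _; rewrite (inj_eq addI).
Qed.

(** The subsets of D of type k whose complement has type l are counted by
    multinomial coefficients.  Removing an element t of D splits the subsets
    into those containing t and those avoiding t; the two contributions are
    weighted by the multiplicities of the type of t in k and in l, whose sum is
    its multiplicity in D. *)
Lemma count_parts_of D k l :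
  ((\sum_(J : {set T} | J \subset D)
     ((parts_of J == k) && (parts_of (D :\: J) == l)))
   * (parts_fact k * parts_fact l)
   = (k `+` l == parts_of D) * parts_fact (parts_of D))%N.
Proof.
have [n] := ubnP #|D|; elim: n D k l => // n IHn D k l.
have [->|[t tD]] := set_0Vmem D => Dn.
  rewrite (big_pred1 set0) => [|J]; last by rewrite /= subset0.
  rewrite set0D /parts_of big_set0.
  case: (altP (mset0 =P k)) => [<-|k0].
    rewrite mset0D [l == _]eq_sym /=; case: eqP => [<-|//].
    by rewrite parts_fact0.
  suff /negPf-> : k `+` l != mset0 by [].
  apply: contra k0 => /eqP/msetP kl; apply/eqP/msetP => x.
  by have := kl x; rewrite msetE2 mset0E => /eqP; rewrite addn_eq0 => /andP[/eqP ->].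
have [D' defD tD'] : exists2 D', D = t |: D' & t \notin D'.
  by exists (D :\ t); rewrite ?setD1K // !inE eqxx.
rewrite {}defD in Dn *; rewrite sum_subsetU1 //=.
have IH k' l' : ((\sum_(J : {set T} | J \subset D')
     ((parts_of J == k') && (parts_of (D' :\: J) == l'))) *
     (parts_fact k' * parts_fact l')
   = (k' `+` l' == parts_of D') * parts_fact (parts_of D'))%N.
  by apply: IHn; move: Dn; rewrite cardsU1 tD'.
have stepL := count_pairs_step (ty t) IH k l.
(* The same step with the roles of a subset and of its complement exchanged. *)
have stepR := @count_pairs_step _ (fun J : {set T} => J \subset D')
  (fun J => parts_of (D' :\: J)) parts_of (parts_of D') (ty t) _ l k.
rewrite parts_ofU1 // parts_fact1D.
have -> : ((k `+` l == ty t +` parts_of D') * ((parts_of D' (ty t)).+1 *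
   parts_fact (parts_of D')) = (k (ty t) + l (ty t)) *
   ((k `+` l == ty t +` parts_of D') * parts_fact (parts_of D')))%N.
  case: eqP => [/msetP/(_ (ty t))|_]; last by rewrite muln0.
  by rewrite msetE2 mset1DE eqxx add1n !mul1n => ->.
rewrite [RHS]mulnDl -stepL [k `+` l]msetDC -stepR => [|k' l'].
  move: (parts_fact k) (parts_fact l) => a b {stepL stepR}.
  rewrite [(b * a)%N]mulnC -[RHS]mulnDl -big_split /=.
  congr muln; apply: eq_bigr => J JD.
  have tJ : t \notin J by apply: contra tD'; apply: (subsetP JD).
  have -> : (t |: D') :\: (t |: J) = D' :\: J.
    apply/setP=> x; rewrite !in_setD !in_setU1; case: eqP => [->|//].
    by rewrite (negPf tD') andbF.
  have -> : (t |: D') :\: J = t |: (D' :\: J).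
    apply/setP=> x; rewrite !in_setD !in_setU1 in_setD; case: eqP => [->|//].
    by rewrite !orTb andbT; apply: tJ.
  rewrite !parts_ofU1 //; last by rewrite in_setD (negPf tD') andbF.
  by congr addn; rewrite andbC.
rewrite [k' `+` l']msetDC -IH.
move: (parts_fact k') (parts_fact l') => a b; rewrite [(b * a)%N]mulnC; congr muln.
by apply: eq_bigr => J _; rewrite andbC.
Qed.

End Types.

(** Extension by zero to partitions of any size.  It lets sums over all subsets
    be written down without tracking sizes: subsets of the wrong size
    contribute nothing. *)
Definition parks_ext n (f : Parks gT n) l : int :=
  \sum_(k : Parts_n gT n | parts_val k == l) f k.

Lemma parks_ext_val n (f : Parks gT n) (k : Parts_n gT n) : parks_ext f k = f k.
Proof. by rewrite /parks_ext (big_pred1 k) // => k'; rewrite (inj_eq (@parts_val_inj n)). Qed.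

Lemma parks_ext_eq0 n (f : Parks gT n) l : parts_norm l != n -> parks_ext f l = 0.
Proof.
move=> ln; rewrite /parks_ext big_pred0 // => k; apply/negbTE.
by apply: contra ln => /eqP <-; apply: parts_valP.
Qed.

Lemma parks_ext_power n f l :
  parks_ext (marks_power n f) l = (parts_norm l == n)%:R * parts_eval f l.
Proof.
case: (altP (parts_norm l =P n)) => [ln|ln]; last by rewrite parks_ext_eq0 ?mul0r.
have lP : parts_norm l == n by rewrite ln.
by rewrite mul1r -[l]/(parts_val (PartsN lP)) parks_ext_val ffunE.
Qed.

(** The star product as a sum over subsets of any set D whose multiset of types
    is mu: the multinomial coefficient in its definition is the number of
    subsets giving the same pair of partitions. *)
Lemma parks_starE (i j n : nat) (f : Parks gT i) (g : Parks gT j) (mu : Parts_n gT n)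
    (T : finType) (ty : T -> Conj gT * pos_nat) (D : {set T}) :
  parts_of ty D = mu ->
  parks_star f g mu = \sum_(J : {set T} | J \subset D)
    parks_ext f (parts_of ty J) * parks_ext g (parts_of ty (D :\: J)).
Proof.
move=> muE; rewrite ffunE /parks_ext.
transitivity (\sum_(k : Parts_n gT i) \sum_(l : Parts_n gT j)
    \sum_(J : {set T} | J \subset D)
      ((parts_of ty J == parts_val k) && (parts_of ty (D :\: J) == parts_val l))%:R * (f k * g l)).
  apply: eq_bigr => k _; rewrite big_mkcond; apply: eq_bigr => l _.
  rewrite -mulr_suml -natr_sum -muE.
  have := count_parts_of ty D (parts_val k) (parts_val l); set N := (\sum_(J | _) _)%N => NE.
  have kl_gt0 : (0 < parts_fact (parts_val k) * parts_fact (parts_val l))%N.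
    by rewrite muln_gt0 !parts_fact_gt0.
  (* The count makes the quotient in the definition of the star product exact. *)
  rewrite -[N](mulnK _ kl_gt0) NE; case: eqP => _.
    by rewrite mul1n mulrA.
  by rewrite mul0n div0n mul0r.
under [RHS]eq_bigr => J _.
  rewrite mulr_suml big_mkcond.
  under eq_bigr => k _ do rewrite mulr_sumr [X in if _ then X else _]big_mkcond.
  over.
rewrite [RHS]exchange_big; apply: eq_bigr => k _.
rewrite exchange_big; apply: eq_bigr => J _.
case: (altP (parts_val k =P _)) => [<-|kJ].
  by apply: eq_bigr => l _; rewrite eqxx eq_sym; case: eqP; rewrite ?mul1r ?mul0r.
by rewrite big1 // => l _; rewrite eq_sym (negPf kJ) mul0r.
Qed.

Lemma parts_of_surj l :
  exists (m : nat) (ty : 'I_m -> Conj gT * pos_nat), parts_of ty [set: 'I_m] = l.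
Proof.
exists (size (enum_mset l)), (tnth (in_tuple (enum_mset l))).
apply/msetP => k; rewrite parts_ofE -[RHS]count_mem_mset -sum1_count.
rewrite (big_tnth _ _ (enum_mset l)) [RHS]big_mkcond /=.
by apply: eq_big => t; rewrite ?inE.
Qed.

Lemma parts_eval_norm0 f l :
  parts_norm l = 0%N -> parts_eval f l = 1.
Proof.
have [[|m] [ty <-]] := parts_of_surj l.
  by move=> _; rewrite parts_eval_parts_of big1 // => -[].
rewrite parts_norm_parts_of (bigD1 ord0) ?inE //= => /eqP.
by rewrite addn_eq0 -leqn0 leqNgt (valP (ty ord0).2).
Qed.

(** The product of the sums f + g over the elements of mu expands as a sum over
    the subsets where f is chosen; the degree i is the total size of that
    subset. *)
Lemma marks_powerD n f g : marks_power n (f + g) =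
  \sum_(i < n.+1) parks_star (marks_power i f) (marks_power (n - i) g).
Proof.
apply/ffunP=> mu; rewrite sum_ffunE ffunE.
have [m [ty muE]] := parts_of_surj mu.
under [RHS]eq_bigr => i _ do rewrite (parks_starE _ _ muE).
rewrite exchange_big -muE parts_eval_parts_of /=.
under eq_bigl => t do rewrite inE.
under eq_bigr => t _ do rewrite ffunE.
rewrite bigA_distr /=; apply: eq_big => [J|J _]; first by rewrite subsetT.
have nE : (parts_norm (parts_of ty J) + parts_norm (parts_of ty ([set: 'I_m] :\: J)) = n)%N.
  by rewrite -parts_normD parts_ofD ?subsetT // muE; apply/eqP/parts_valP.
have Jn : (parts_norm (parts_of ty J) < n.+1)%N by rewrite ltnS -nE leq_addr.
rewrite (bigD1 (Ordinal Jn)) //= [X in _ = _ + X]big1 => [|i iJ]; last first.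
  rewrite parks_ext_power; case: eqP => [E|_]; last by rewrite !mul0r.
  by case/eqP: iJ; apply: val_inj; rewrite /= E.
rewrite addr0 !parks_ext_power eqxx -[X in _ == (X - _)%N]nE addKn eqxx !mul1r.
rewrite !parts_eval_parts_of (bigID (mem J)) /=; congr (_ * _).
  by apply: eq_big => // i ->.
by apply: eq_big => i; rewrite ?inE ?andbT // => /negPf ->.
Qed.

(** In degree 0 every power is the unit for the star product.  The degree is a
    variable j equal to 0 because it occurs below as n - n. *)
Lemma parks_star_power0 n j (f : Parks gT n) h : j = 0%N ->
  parks_star f (marks_power j h) = f.
Proof.
move=> j0; apply/ffunP => mu; have [m [ty muE]] := parts_of_surj mu.
rewrite (parks_starE _ _ muE) (bigD1 setT) //= big1 => [|J /andP[_ JT]].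
  rewrite setDv muE parks_ext_val parks_ext_power /parts_of big_set0.
  by rewrite parts_norm0 parts_eval0 j0 addr0 !mulr1.
rewrite parks_ext_power j0; case: eqP => [|_]; last by rewrite mul0r mulr0.
rewrite parts_norm_parts_of => /eqP; rewrite sum_nat_eq0 => /forallP JC0.
case/negP: JT; rewrite eqEsubset subsetT; apply/subsetP => t _.
apply/negPn/negP => tJ; have := JC0 t; rewrite !inE tJ /=.
by rewrite -leqn0 leqNgt (valP (ty t).2).
Qed.

End PartsCombinatorics.

(** * Marks of a transfer product *)

Section MarksLinear.
Variable gT : finGroupType.

Fact marks_is_additive : zmod_morphism (@marks gT).
Proof.
move=> x y; apply/ffunP=> c; rewrite !ffunE -sumrB; apply: eq_bigr => d _.
by rewrite !ffunE mulrBl.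
Qed.
HB.instance Definition _ :=
  GRing.isZmodMorphism.Build (burnside gT) (Marks gT) (@marks gT) marks_is_additive.

Lemma burnside_sum (x : burnside gT) : x = \sum_c basis c *~ x c.
Proof.
apply/ffunP=> d; rewrite sum_ffunE (bigD1 d) //= big1 => [|c cd].
  by rewrite ffunMzE ffunE eqxx addr0 intz.
by rewrite ffunMzE ffunE eq_sym (negPf cd) mul0rz.
Qed.

Lemma marksE (x : burnside gT) c : marks x c = \sum_d marks (basis d) c * x d.
Proof.
rewrite {1}(burnside_sum x) (raddf_sum (@marks _)) sum_ffunE; apply: eq_bigr => d _.
by rewrite (raddfMz (@marks _)) ffunMzE -mulrzr intz.
Qed.

Lemma marks_basis (L H : {group gT}) :
  marks (basis (conj_of L)) (conj_of H) * #|L|%:R = (transporter_card H L)%:R.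
Proof. by rewrite -gclass_coset marks_gclass -natrM card_gfix_coset. Qed.

Lemma coset_reps (H : {group gT}) : exists2 pt : coset_gset H,
  orbit_reps (gset_act (coset_gset H)) [set: gT] [set pt] &
  'C[pt | gset_act (coset_gset H)]%g = H.
Proof.
have ptP : (H : {set gT}) \in lcosets H [set: gT].
  by apply/lcosetsP; exists 1%g; rewrite ?inE // mul1g.
exists (Sub (H : {set gT}) ptP).
  split=> [x y /set1P -> /set1P -> //|A]; eexists; first exact: set11.
  rewrite orbit_sym; apply/orbit_gsetP; have /lcosetsP[a _ E] := valP A.
  by exists a; apply: val_inj; rewrite /= E lcosetE.
apply/setP=> a; rewrite in_stab -val_eqE /= lcosetE.
by apply/eqP/idP => [<-|aH]; [apply: lcoset_refl|apply: lcoset_id].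
Qed.

End MarksLinear.

Section BlockStar.
Variables (gT : finGroupType) (i j n : nat) (e : (i + j)%N = n).
Local Notation phi := (block_morphism gT e).
Local Notation inL := (fun a : 'I_i => block_join e (inl a)).
Local Notation inR := (fun b : 'I_j => block_join e (inr b)).
Implicit Types (K H : {group wr gT n}) (L : {group wr gT i}) (M : {group wr gT j}).

Lemma wbase_blockl p a : wbase (phi p) (inL a) = wbase p.1 a.
Proof. by rewrite ffunE block_joinK. Qed.
Lemma wbase_blockr p b : wbase (phi p) (inR b) = wbase p.2 b.
Proof. by rewrite ffunE block_joinK. Qed.
Lemma wperm_blockl p a : wperm (phi p) (inL a) = inL (wperm p.1 a).
Proof. by rewrite permE /block_perm_fun block_joinK. Qed.
Lemma wperm_blockr p b : wperm (phi p) (inR b) = inR (wperm p.2 b).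
Proof. by rewrite permE /block_perm_fun block_joinK. Qed.

Lemma wr_eqP m (u v : wr gT m) :
  wbase u =1 wbase v -> wperm u =1 wperm v -> u = v.
Proof. by case: u v => g s [h t] /= /ffunP -> /permP ->. Qed.

Lemma block_inj : injective phi.
Proof.
have joinI := can_inj (block_joinK e).
move=> [u v] [u' v'] E; congr pair; apply: wr_eqP => a.
- by have := congr1 (fun w => wbase w (inL a)) E; rewrite !wbase_blockl.
- have := congr1 (fun w => wperm w (inL a)) E; rewrite !wperm_blockl => /joinI[].
  by [].
- by have := congr1 (fun w => wbase w (inR a)) E; rewrite !wbase_blockr.
- by have := congr1 (fun w => wperm w (inR a)) E; rewrite !wperm_blockr => /joinI[].
Qed.

Lemma block_injm : ('injm phi)%g.
Proof. by apply/injmP => p q _ _; apply: block_inj. Qed.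

Lemma star_basis L M : star e (basis (conj_of L)) (basis (conj_of M)) =
  basis (conj_of (phi @* setX L M)%G).
Proof.
rewrite -[basis (conj_of L)]gclass_coset -[basis (conj_of M)]gclass_coset star_gclass.
have [x xR xL] := coset_reps L; have [y yR yM] := coset_reps M.
rewrite (gclass_balanced _ (orbit_reps_prod xR yR)).
have -> : setX [set x] [set y] = [set (x, y)].
  by apply/setP=> -[x' y']; rewrite !inE.
rewrite big_set1.
congr (basis (conj_of _)); apply: val_inj; congr (_ @* _)%g.
apply/setP=> -[u v]; rewrite in_setX (@in_stab _ (prod_gset _ _)).
by move/setP: xL => /(_ u) <-; move/setP: yM => /(_ v) <-; rewrite !in_stab.
Qed.

Definition star_class c d :=
  conj_of (phi @* setX (conj_repr c) (conj_repr d))%G.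

Lemma star_basis_class c d : star e (basis c) (basis d) = basis (star_class c d).
Proof. by rewrite -[in LHS](conj_reprK c) -[in LHS](conj_reprK d) star_basis. Qed.

Lemma starE x y :
  star e x y = \sum_c \sum_d basis (star_class c d) *~ (x c * y d).
Proof.
apply: eq_bigr => c _; apply: eq_bigr => d _; congr (_ *~ _).
by rewrite -star_gclass !gclass_coset star_basis.
Qed.

Definition block_left K : {group wr gT i} := (fst_morphism _ _ @* (phi @*^-1 K))%G.
Definition block_right K : {group wr gT j} := (snd_morphism _ _ @* (phi @*^-1 K))%G.

Lemma block_leftP K u :
  reflect (exists v, phi (u, v) \in K) (u \in block_left K).
Proof.
apply: (iffP imsetP) => [[[u' v]]|[v uvK]].
  by rewrite !inE => uvK /= ->; exists v.
by exists (u, v); rewrite // !inE.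
Qed.
Lemma block_rightP K v :
  reflect (exists u, phi (u, v) \in K) (v \in block_right K).
Proof.
apply: (iffP imsetP) => [[[u v']]|[u uvK]].
  by rewrite !inE => uvK /= ->; exists u.
by exists (u, v); rewrite // !inE.
Qed.

(** A subgroup of the block subgroup need not be the product of its two
    projections, but it lies in a product exactly when its projections do. *)
Lemma sub_block K (A : {set wr gT i}) (B : {set wr gT j}) :
  (K \subset phi @* setX A B)%g =
  [&& K \subset phi @* setT, block_left K \subset A & block_right K \subset B]%g.
Proof.
have in_phi p (C : {set wr gT i * wr gT j}) : (phi p \in phi @* C)%g = (p \in C).
  apply/imsetP/idP => [[q /setIP[_ qC] /block_inj ->] //|pC].
  by exists p; rewrite // in_setI in_setT.
apply/idP/and3P => [sK|[sK sL sM]].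
  split.
  - by apply: subset_trans sK (morphimS _ (subsetT _)).
  - apply/subsetP=> u /block_leftP[v uv]; have := subsetP sK _ uv.
    by rewrite in_phi !inE => /andP[].
  apply/subsetP=> v /block_rightP[u uv]; have := subsetP sK _ uv.
  by rewrite in_phi !inE => /andP[].
apply/subsetP=> w wK; have /imsetP[[u v] _ E] := subsetP sK _ wK.
rewrite E in wK *; rewrite in_phi inE (subsetP sL) ?(subsetP sM) //.
  by apply/block_rightP; exists u.
by apply/block_leftP; exists v.
Qed.

Lemma sub_blockJ K L M a b :
  (K :^ phi (a, b) \subset phi @* setX L M)%g =
  [&& K \subset phi @* setT, block_left K :^ a \subset L &
      block_right K :^ b \subset M]%g.
Proof.
rewrite sub_conjg -morphV ?inE // -morphimJ ?inE //.
have -> : (setX L M :^ (a, b)^-1 = setX (L :^ a^-1) (M :^ b^-1))%g.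
  by apply/setP=> -[u v]; rewrite mem_conjg !inE /= !mem_conjg.
by rewrite sub_block -!sub_conjg.
Qed.

(** Both sides, multiplied by #|L| * #|M|, count the triples (l, a, b) such that
    l (a, b) conjugates H into the block image of L x M: on the left one first
    absorbs (a, b) into l, on the right one first fixes l. *)
Lemma marks_star_basis L M H :
  marks (star e (basis (conj_of L)) (basis (conj_of M))) (conj_of H)
    * (#|{: wr gT i}| * #|{: wr gT j}|)%:R =
  \sum_(l | (H :^ l \subset phi @* setT)%g)
    marks (basis (conj_of L)) (conj_of (block_left (H :^ l)%G)) *
    marks (basis (conj_of M)) (conj_of (block_right (H :^ l)%G)).
Proof.
have nz (gT' : finGroupType) (A : {group gT'}) : #|A|%:R != 0 :> int.
  by rewrite pnatr_eq0 -lt0n cardG_gt0.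
apply: (mulIf (nz _ L)); apply: (mulIf (nz _ M)).
transitivity ((\sum_(l | (H :^ l \subset phi @* setT)%g)
    transporter_card (block_left (H :^ l)%G) L *
    transporter_card (block_right (H :^ l)%G) M)%N%:R : int); last first.
  rewrite natr_sum !mulr_suml; apply: eq_bigr => l _.
  by rewrite natrM -!marks_basis mulrACA mulrA.
have cardLM : (#|(phi @* setX L M)%g| = #|L| * #|M|)%N.
  by rewrite card_injm ?subsetT ?block_injm // cardsX.
rewrite star_basis -!mulrA -!natrM -cardLM mulnC natrM mulrA.
rewrite marks_basis -natrM; congr (_%:R).
have tcE (rT : finGroupType) (A B : {set rT}) :
    transporter_card A B = (\sum_a (A :^ a \subset B)%g)%N.
  by rewrite /transporter_card -sum1_card big_mkcond; apply: eq_bigr => a _; rewrite inE.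
transitivity (\sum_a \sum_b \sum_l ((H :^ l) :^ phi (a, b) \subset phi @* setX L M)%g)%N.
  rewrite mulnC -mulnA -sum_nat_const; apply: eq_bigr => a _.
  rewrite -sum_nat_const; apply: eq_bigr => b _.
  rewrite tcE (reindex_inj (mulIg (phi (a, b)))) /=.
  by apply: eq_bigr => l _; rewrite conjsgM.
under eq_bigr => a _ do rewrite exchange_big.
rewrite exchange_big [RHS]big_mkcond; apply: eq_bigr => l _ /=.
under eq_bigr => a _ do under eq_bigr => b _ do rewrite (@sub_blockJ (H :^ l)%G).
case: ifP => _; last by rewrite big1 // => a _; rewrite big1.
rewrite !tcE big_distrlr; apply: eq_bigr => a _; apply: eq_bigr => b _.
by rewrite andTb -mulnb.
Qed.

(** The marks of a transfer product are an average over the conjugates of H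
    inside the block subgroup. *)
Lemma marks_star x y H :
  marks (star e x y) (conj_of H) * (#|{: wr gT i}| * #|{: wr gT j}|)%:R =
  \sum_(l | (H :^ l \subset phi @* setT)%g)
    marks x (conj_of (block_left (H :^ l)%G)) *
    marks y (conj_of (block_right (H :^ l)%G)).
Proof.
pose A c l := marks (basis c) (conj_of (block_left (H :^ l)%G)).
pose B d l := marks (basis d) (conj_of (block_right (H :^ l)%G)).
transitivity (\sum_c \sum_d
    (\sum_(l | (H :^ l \subset phi @* setT)%g) A c l * B d l) * (x c * y d)).
  rewrite starE (raddf_sum (@marks _)) sum_ffunE mulr_suml; apply: eq_bigr => c _.
  rewrite (raddf_sum (@marks _)) sum_ffunE mulr_suml; apply: eq_bigr => d _.
  rewrite (raddfMz (@marks _)) ffunMzE -mulrzr mulrAC intz; congr (_ * _).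
  by rewrite -star_basis_class -(conj_reprK c) -(conj_reprK d) marks_star_basis !conj_reprK.
under eq_bigr => c _ do under eq_bigr => d _ do rewrite mulr_suml.
under eq_bigr => c _ do rewrite exchange_big.
rewrite exchange_big; apply: eq_bigr => l _ /=.
rewrite (marksE x) (marksE y) mulr_suml; apply: eq_bigr => c _.
rewrite mulr_sumr; apply: eq_bigr => d _.
by rewrite mulrACA.
Qed.

End BlockStar.

(** * Stable subsets of the index set *)

Section OrbitTypes.
Variables (gT : finGroupType) (n : nat).
Local Notation to := (wr_idx gT n).
Implicit Types (H K : {group wr gT n}) (A : {set 'I_n}).

(** The summand ([H_kk], |Hk|) of beta([H]) contributed by the orbit of k. *)
Definition orbit_type H k := (conj_of (isotropy_group H k), orbit_size H k).

Lemma orbit_typeJ H a k : orbit_type (H :^ a)%G (to k a) = orbit_type H k.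
Proof.
congr pair.
  by apply/eqP; rewrite eq_sym; apply/conj_ofP; exists (wbase a k); apply: isotropyJ.
apply: val_inj => /=; rewrite -[RHS](card_imset _ (act_inj to a)).
apply: eq_card => x.
rewrite -[x](actKV to a) orbit_conjsg; apply/idP/imsetP => [xk|[y yk /act_inj ->//]].
by exists (to x a^-1%g).
Qed.

Lemma orbit_type_orbit H k l : l \in orbit to H k -> orbit_type H l = orbit_type H k.
Proof.
case/orbitP=> b bH <-; rewrite -[RHS](orbit_typeJ _ b).
by have -> : (H :^ b)%G = H by apply/val_inj/conjGid.
Qed.

Definition orbit_repset H := orbit_transversal to H [set: 'I_n].

Lemma beta_partsE H : parts_val (beta H) = parts_of (orbit_type H) (orbit_repset H).
Proof. by []. Qed.

(** Summing over the indices in a stable set, and not over orbit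
    representatives, replaces a choice of representatives by a weight, the
    orbit size. *)
Lemma sum_stable_orbits H A (F : Conj gT * pos_nat -> nat) :
  (H \subset 'N(A | to))%g ->
  (\sum_(t in orbit_repset H :&: A) F (orbit_type H t) * val (orbit_type H t).2 =
   \sum_(x in A) F (orbit_type H x))%N.
Proof.
move=> HA; rewrite [RHS]big_mkcond -(sum_orbit_transversal to H) /=.
rewrite big_mkcond [RHS]big_mkcond; apply: eq_bigr => t _.
rewrite inE -/(orbit_repset H); case: (t \in orbit_repset H) => //=.
have stA y : y \in orbit to H t -> (y \in A) = (t \in A).
  by case/orbitP=> a aH <-; apply: (acts_act HA).
under eq_bigr => y yt do rewrite stA // (orbit_type_orbit yt).
case: ifP => _; last by rewrite big1.
by rewrite sum_nat_const mulnC.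
Qed.

Lemma parts_norm_stable H A : (H \subset 'N(A | to))%g ->
  parts_norm (parts_of (orbit_type H) (orbit_repset H :&: A)) = #|A|.
Proof.
move=> HA; rewrite parts_norm_parts_of -sum1_card -(sum_stable_orbits (fun=> 1%N) HA).
by apply: eq_bigr => t _; rewrite mul1n.
Qed.

(** Since orbit sizes are positive, counting the indices of each type determines
    the multiset of orbit types.  This is how partitions attached to different
    groups are compared below, without matching orbit representatives. *)
Lemma parts_of_stable H A k : (H \subset 'N(A | to))%g ->
  (parts_of (orbit_type H) (orbit_repset H :&: A) k * val k.2 =
   #|[set x in A | orbit_type H x == k]|)%N.
Proof.
move=> HA; rewrite parts_ofE big_distrl -sum1_card.
transitivity (\sum_(x in A) (orbit_type H x == k))%N; last first.
  by rewrite big_mkcond [RHS]big_mkcond; apply: eq_bigr => x _; rewrite inE; case: (x \in A).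
rewrite -(sum_stable_orbits (fun h => (h == k) : nat) HA).
by apply: eq_bigr => t _; case: eqP => // ->.
Qed.

(** Stable sets correspond to sets of orbits; A is the union of the orbits
    with a representative in J. *)
Lemma stable_saturation H (J : {set 'I_n}) : J \subset orbit_repset H ->
  exists A, forall A', (H \subset 'N(A' | to))%g && (orbit_repset H :&: A' == J) = (A' == A).
Proof.
have [repI repE] := transversal_reps to H => JX.
have stO A (HA : (H \subset 'N(A | to))%g) x t : x \in orbit to H t -> (x \in A) = (t \in A).
  by case/orbitP=> a aH <-; apply: (acts_act HA).
exists [set x | [exists t in J, x \in orbit to H t]] => A'.
apply/andP/eqP => [[HA' /eqP XA']|->].
  apply/setP=> x; rewrite inE; apply/idP/exists_inP => [xA|[t]].
    have [t tX tx] := repE x; exists t; last by rewrite orbit_sym.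
    by rewrite -XA' inE tX (stO _ HA' _ _ tx).
  by rewrite -XA' inE => /andP[_ tA] /(stO _ HA') ->.
split.
  apply/subsetP=> a aH; rewrite !inE; apply/subsetP=> x.
  rewrite !inE => /exists_inP[t tJ xt]; apply/exists_inP; exists t => //.
  by apply: orbit_trans xt; apply: mem_orbit.
apply/eqP/setP=> x; rewrite !inE; apply/andP/idP => [[xX /exists_inP[t tJ xt]]|xJ].
  by rewrite -(repI t x) //; apply: (subsetP JX).
by split; [apply: (subsetP JX) | apply/exists_inP; exists x; rewrite ?orbit_refl].
Qed.

End OrbitTypes.

(** Orbit types only depend on the permutations and on the base coordinates along
    the orbit, so they are preserved by an embedding of index sets that matches
    the actions of K and L. *)
Lemma orbit_type_embed (gT : finGroupType) m n (K : {group wr gT n})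
    (L : {group wr gT m}) (h : 'I_m -> 'I_n) :
  injective h ->
  (forall w, w \in K -> exists2 u, u \in L & forall a,
     wbase w (h a) = wbase u a /\ wperm w (h a) = h (wperm u a)) ->
  (forall u, u \in L -> exists2 w, w \in K & forall a,
     wbase w (h a) = wbase u a /\ wperm w (h a) = h (wperm u a)) ->
  forall a, orbit_type K (h a) = orbit_type L a.
Proof.
move=> hI KL LK a; congr pair.
  congr conj_of; apply: val_inj; apply/setP=> x.
  apply/imsetP/imsetP => [[w /setIdP[wK /eqP wa] ->]|[u /setIdP[uL /eqP ua] ->]].
    have [u uL uw] := KL w wK; have [-> E] := uw a; exists u => //.
    by rewrite inE uL /= -(inj_eq hI) -E wa eqxx.
  have [w wK uw] := LK u uL; have [<- E] := uw a; exists w => //.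
  by rewrite inE wK /= E ua eqxx.
apply: val_inj => /=; rewrite -[RHS](card_imset _ hI); apply: eq_card => x.
apply/orbitP/imsetP => [[w wK <-]|[_ /orbitP[u uL <-] ->]].
  have [u uL uw] := KL w^-1%g (groupVr wK); have [_ E] := uw a.
  exists (wperm u a); last by rewrite -E.
  by apply/orbitP; exists u^-1%g; rewrite ?groupV //= /wr_idx_fun wpermV invgK.
have [w wK uw] := LK u^-1%g (groupVr uL); have [_ E] := uw a.
exists w^-1%g; rewrite ?groupV //= /wr_idx_fun wpermV invgK E.
by congr h; rewrite /wr_idx_fun wpermV.
Qed.

Section StableSubsets.
Variables (gT : finGroupType) (i j n : nat) (e : (i + j)%N = n).
Local Notation phi := (block_morphism gT e).
Local Notation inL := (fun a : 'I_i => block_join e (inl a)).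
Local Notation inR := (fun b : 'I_j => block_join e (inr b)).
Local Notation to := (wr_idx gT n).
Implicit Types (H K : {group wr gT n}) (A : {set 'I_n}).

Definition left_block : {set 'I_n} := [set inL a | a : 'I_i].

Lemma inL_inj : injective inL.
Proof. by move=> a b /(can_inj (block_joinK e)) []. Qed.
Lemma inR_inj : injective inR.
Proof. by move=> a b /(can_inj (block_joinK e)) []. Qed.

Lemma inL_left a : inL a \in left_block.
Proof. exact: imset_f. Qed.
Lemma inR_left b : inR b \notin left_block.
Proof. by apply/imsetP => -[a _ /(can_inj (block_joinK e))]. Qed.
Lemma notin_left k : k \notin left_block -> exists b, k = inR b.
Proof.
rewrite -(block_splitK e k); case: (block_split e k) => [a|b _]; last by exists b.
by rewrite inL_left.
Qed.

Lemma card_left_block : #|left_block| = i.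
Proof. by rewrite card_imset ?card_ord //; apply: inL_inj. Qed.

Lemma card_wr m : #|{: wr gT m}| = (#|gT| ^ m * m`!)%N.
Proof.
have pairK : cancel (@pair_wr gT m) (@wr_pair gT m) by case.
rewrite -(card_imset _ (can_inj (@wr_pairK gT m))) -[LHS]cardsE.
have -> : [set x in [set wr_pair x | x : wr gT m]] = [set: {ffun 'I_m -> gT} * 'S_m].
  by apply/setP=> p; rewrite !inE -[p]pairK imset_f.
by rewrite cardsT card_prod card_ffun card_ord -cardsT card_Sn.
Qed.

(** The wreath product acts transitively on subsets of a given size: listing A and
    then its complement yields a permutation carrying the first i indices to
    A. *)
Lemma orbit_left_block :
  orbit (to^*)%act [set: wr gT n] left_block = [set A : {set 'I_n} | #|A| == i].
Proof.
apply/setP=> A; rewrite inE; apply/orbitP/eqP => [[w _ <-]|cardA].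
  by rewrite /= card_setact card_left_block.
have : perm_eq (enum A ++ enum (~: A)) (ord_tuple n).
  apply: uniq_perm; first 1 last.
  - by rewrite val_ord_tuple enum_uniq.
  - move=> k; rewrite mem_cat val_ord_tuple !mem_enum !inE.
    by case: (k \in A).
  - rewrite cat_uniq !enum_uniq andbT; apply/hasPn=> k.
    by rewrite !mem_enum inE.
case/tuple_permP => p pE.
(* The inverse appears because w acts on indices through (wperm w)^-1. *)
exists (Wr [ffun=> 1%g] p^-1%g : wr gT n); first by rewrite inE.
apply/eqP; rewrite eqEcard /= card_setact card_left_block cardA leqnn andbT.
apply/subsetP=> _ /imsetP[_ /imsetP[a _ ->] ->]; rewrite /= /wr_idx_fun /= invgK.
set k := block_join e (inl a).
have ka : (k < #|A|)%N by rewrite cardA /k /=.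
have -> : p k = nth k (enum A ++ enum (~: A)) k.
  by rewrite pE -tnth_nth tnth_mktuple tnth_ord_tuple.
by rewrite nth_cat -cardE ka -mem_enum mem_nth // -cardE.
Qed.

(** One inclusion is clear; for equality of orders, the index of the stabiliser is
    the binomial coefficient by [orbit_left_block]. *)
Lemma block_imE : (phi @* setT)%g = ('N(left_block | to))%g.
Proof.
apply/eqP; rewrite eqEcard; apply/andP; split.
  apply/subsetP=> _ /imsetP[p _ ->]; rewrite -groupV inE in_setT inE.
  apply/subsetP=> _ /imsetP[a _ ->]; rewrite inE /= /wr_idx_fun.
  by rewrite -wpermV invgK wperm_blockl inL_left.
have cardN := card_orbit_stab (to^*)%act [set: wr gT n]%G left_block.
rewrite setTI astab1_set orbit_left_block card_draws card_ord in cardN.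
have i_n : (i <= n)%N by rewrite -e leq_addr.
have bin_gt0 : (0 < 'C(n, i))%N by rewrite bin_gt0.
rewrite -(leq_pmul2l bin_gt0) cardN cardsT card_injm ?subsetT ?block_injm //.
rewrite cardsT card_prod !card_wr -(bin_fact i_n) -[in (_ - i)%N]e addKn -e expnD.
apply: eq_leq. nia.
Qed.

Lemma card_block_moves A : #|A| = i ->
  #|[set l : wr gT n | (to^*)%act left_block l^-1%g == A]| =
    (#|{: wr gT i}| * #|{: wr gT j}|)%N.
Proof.
move=> cardA; have : A \in orbit (to^*)%act [set: wr gT n] left_block.
  by rewrite orbit_left_block inE cardA.
case/orbitP=> a _ AE.
have <- : #|(phi @* setT)%g| = (#|{: wr gT i}| * #|{: wr gT j}|)%N.
  by rewrite card_injm ?subsetT ?block_injm // cardsT card_prod.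
rewrite block_imE -astab1_set -(card_rcoset _ a) -card_invg.
apply: eq_card => l; rewrite inE mem_invg mem_rcoset.
rewrite -AE; apply/eqP/astab1P => E; first by rewrite actM E actK.
by rewrite -[in LHS](mulgKV a l^-1%g) actM E.
Qed.

(** The elements l averaged over in [marks_star] are the ones for which the set
    carried by l to the first block is H-stable. *)
Lemma block_conj_stable H l :
  (H :^ l \subset phi @* setT)%g = (H \subset 'N((to^*)%act left_block l^-1 | to))%g.
Proof. by rewrite block_imE sub_conjg -!astab1_set astab1_act. Qed.

Lemma orbit_type_left H l a : (H :^ l \subset phi @* setT)%g ->
  orbit_type (block_left e (H :^ l)%G) a = orbit_type H (to (inL a) l^-1%g).
Proof.
move=> sH; rewrite -[RHS](orbit_typeJ _ l) actKV.
apply/esym/(orbit_type_embed inL_inj) => [w wK|u /block_leftP[v uvK]].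
  have /imsetP[[u v] _ E] := subsetP sH w wK.
  exists u => [|b]; first by apply/block_leftP; exists v; rewrite -E.
  by rewrite E wbase_blockl wperm_blockl.
by exists (phi (u, v)) => // b; rewrite wbase_blockl wperm_blockl.
Qed.

Lemma orbit_type_right H l b : (H :^ l \subset phi @* setT)%g ->
  orbit_type (block_right e (H :^ l)%G) b = orbit_type H (to (inR b) l^-1%g).
Proof.
move=> sH; rewrite -[RHS](orbit_typeJ _ l) actKV.
apply/esym/(orbit_type_embed inR_inj) => [w wK|v /block_rightP[u uvK]].
  have /imsetP[[u v] _ E] := subsetP sH w wK.
  exists v => [|b']; first by apply/block_rightP; exists u; rewrite -E.
  by rewrite E wbase_blockr wperm_blockr.
by exists (phi (u, v)) => // b'; rewrite wbase_blockr wperm_blockr.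
Qed.

(** A type-preserving bijection from the index set of L to A gives equal counts of
    indices of each type, and these determine the partitions by
    [parts_of_stable]. *)
Lemma beta_embed m (L : {group wr gT m}) H A (h : 'I_m -> 'I_n) :
  (H \subset 'N(A | to))%g -> injective h -> (forall x, reflect (exists a, x = h a) (x \in A)) ->
  (forall a, orbit_type L a = orbit_type H (h a)) ->
  parts_val (beta L) = parts_of (orbit_type H) (orbit_repset H :&: A).
Proof.
move=> HA hI hA LH; apply/msetP=> k; apply/eqP.
rewrite -(eqn_pmul2r (valP k.2)) parts_of_stable // beta_partsE.
rewrite -[orbit_repset L]setIT parts_of_stable; last first.
  by apply/subsetP=> w _; apply/astabsP=> x; rewrite !inE.
rewrite -(card_imset _ hI); apply/eqP/eq_card => x; rewrite inE.
apply/imsetP/andP => [[a]|[/hA[a ->] ak]].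
  by rewrite !inE /= => ak ->; rewrite -LH ak; split=> //; apply/hA; exists a.
by exists a; rewrite // !inE /= LH.
Qed.

Lemma beta_left H l : (H :^ l \subset phi @* setT)%g ->
  parts_val (beta (block_left e (H :^ l)%G)) =
  parts_of (orbit_type H) (orbit_repset H :&: (to^*)%act left_block l^-1%g).
Proof.
move=> sH; apply: (beta_embed (h := fun a => to (inL a) l^-1%g)).
- by move: sH; rewrite block_conj_stable.
- by move=> a b /act_inj/inL_inj.
- move=> x; apply: (iffP imsetP) => [[_ /imsetP[a _ ->] ->]|[a ->]]; first by exists a.
  by exists (inL a) => //; apply: inL_left.
by move=> a; apply: orbit_type_left.
Qed.

Lemma beta_right H l : (H :^ l \subset phi @* setT)%g ->
  parts_val (beta (block_right e (H :^ l)%G)) =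
  parts_of (orbit_type H) (orbit_repset H :\: (to^*)%act left_block l^-1%g).
Proof.
move=> sH; rewrite setDE; apply: (beta_embed (h := fun b => to (inR b) l^-1%g)).
- by move: sH; rewrite astabsC block_conj_stable.
- by move=> a b /act_inj/inR_inj.
- have stE x : (x \in (to^*)%act left_block l^-1%g) = (to x l \in left_block).
    apply/imsetP/idP => [[y yB ->]|xB]; first by rewrite actKV.
    by exists (to x l); rewrite // actK.
  move=> x; rewrite inE stE; apply: (iffP idP) => [/notin_left[b E]|[b ->]].
    by exists b; rewrite -E actK.
  by rewrite actKV inR_left.
by move=> b; apply: orbit_type_right.
Qed.

Lemma beta_starE m (f : Parks gT m) (H : {group wr gT m}) :
  beta_star f (conj_of H) = f (beta H).
Proof. by rewrite ffunE; congr (f _); apply: beta_conj; rewrite conj_reprK. Qed.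

(** The compatibility of the two star products.  The sum of [marks_star] is
    grouped by the set J of orbits inside the set that l carries to the first
    block; each J whose orbits have total size i arises from exactly as many l as
    the block subgroup has elements, and the other J contribute zero. *)
Lemma beta_star_star f g x y :
  beta_star f = marks x -> beta_star g = marks y ->
  beta_star (parks_star f g : Parks gT n) = marks (star e x y).
Proof.
move=> fx gy; apply/ffunP => c; rewrite -(conj_reprK c); set H := conj_repr c.
have W_neq0 : (#|{: wr gT i}| * #|{: wr gT j}|)%:R != 0 :> int.
  by rewrite pnatr_eq0 -lt0n muln_gt0 -!cardsT !cardG_gt0.
apply: (mulIf W_neq0); rewrite marks_star beta_starE.
rewrite (parks_starE _ _ (esym (beta_partsE H))) mulr_suml.
pose mv l := (to^*)%act left_block l^-1%g.
rewrite [RHS](partition_big (fun l => orbit_repset H :&: mv l)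
  (fun J => J \subset orbit_repset H)) /= => [|l _]; last exact: subsetIl.
apply: eq_bigr => J JX.
transitivity (\sum_(l | (H :^ l \subset phi @* setT)%g && (orbit_repset H :&: mv l == J))
   parks_ext f (parts_of (orbit_type H) J) *
   parks_ext g (parts_of (orbit_type H) (orbit_repset H :\: J))); last first.
  apply: eq_bigr => l /andP[sH /eqP <-].
  rewrite -fx -gy !beta_starE -(parks_ext_val f) -(parks_ext_val g).
  rewrite (beta_left sH) (beta_right sH).
  by rewrite setDIr setDv set0U.
rewrite sumr_const.
have [JP|JP] := eqVneq (parts_norm (parts_of (orbit_type H) J)) i; last first.
  by rewrite parks_ext_eq0 // !mul0r mul0rn.
have [A AP] := stable_saturation JX.
have /andP[HA /eqP XA] : (H \subset 'N(A | to))%g && (orbit_repset H :&: A == J).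
  by rewrite AP.
have cardA : #|A| = i by rewrite -(parts_norm_stable HA) XA.
rewrite mulr_natr -(card_block_moves cardA); congr (_ *+ _).
apply: eq_card => l; rewrite inE -AP unfold_in; congr andb.
exact/esym/block_conj_stable.
Qed.

End StableSubsets.

(** * Marks of a cartesian power *)

Section Powers.
Variables (gT : finGroupType) (n : nat).
Local Notation to := (wr_idx gT n).
Implicit Types (X : gset gT) (H : {group wr gT n}).

Lemma gfixP (rT : finGroupType) (Y : gset rT) (A : {set rT}) (y : Y) :
  reflect (forall a, a \in A -> lact a y = y) (y \in gfix Y A).
Proof. by rewrite inE; apply: (iffP forall_inP) => yA a /yA/eqP. Qed.

Lemma gfix_powE X H (x : pow_gset n X) w k : x \in gfix (pow_gset n X) H -> w \in H ->
  x (wperm w k) = lact (wbase w (wperm w k)) (x k).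
Proof.
by move=> /gfixP xH wH; rewrite -[in LHS](xH w wH) ffunE permK.
Qed.

Lemma gfix_pow_isotropy X H (x : pow_gset n X) k :
  x \in gfix (pow_gset n X) H -> x k \in gfix X (isotropy H k).
Proof.
move=> xH; apply/gfixP => _ /imsetP[w /setIdP[wH /eqP wk] ->].
by have := gfix_powE k xH wH; rewrite wk.
Qed.

Lemma orbit_rep H k : exists2 t, t \in orbit_repset H & exists2 w, w \in H & wperm w t = k.
Proof.
have [_ /(_ k)[t tX]] := transversal_reps to H.
case/orbitP=> w wH kt; exists t => //; exists w => //.
by rewrite -kt /= /wr_idx_fun permKV.
Qed.

(** Coordinates prescribed at orbit representatives propagate along the orbits.  Two
    elements of H carrying a representative t to the same index differ by an
    element of H fixing t, whose base coordinate at t lies in H_tt: this is why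
    fixed points of H_tt are needed and why they suffice. *)
Lemma gfix_pow_extend X H (y : 'I_n -> X) :
  (forall t, t \in orbit_repset H -> y t \in gfix X (isotropy H t)) ->
  exists2 x : pow_gset n X, x \in gfix (pow_gset n X) H &
    forall t, t \in orbit_repset H -> x t = y t.
Proof.
move=> yH; have [repI _] := transversal_reps to H.
have repE t t' w w' : t \in orbit_repset H -> t' \in orbit_repset H ->
    w \in H -> w' \in H -> wperm w t = wperm w' t' ->
  lact (wbase w (wperm w t)) (y t) = lact (wbase w' (wperm w t)) (y t').
  move=> tX tX' wH wH' E.
  have tt' : t = t'.
    apply: repI => //; apply/orbitP; exists (w'^-1 * w)%g^-1%g.
      by rewrite groupV groupM ?groupV.
    by rewrite /= /wr_idx_fun -wpermV invgK wpermM wpermV permM E permK.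
  subst t'; have /gfixP/(_ (wbase (w^-1 * w') t)%g) := yH t tX.
  rewrite wbaseM wbaseV wpermV invgK lactM => fx.
  rewrite -[in LHS]fx; first by rewrite -lactM mulgV lact1.
  apply/imsetP; exists (w^-1 * w')%g.
    by rewrite inE groupM ?groupV //= permM -E permK eqxx.
  by rewrite wbaseM wbaseV wpermV invgK.
have [x xE] : exists x : {ffun 'I_n -> X}, forall t w, t \in orbit_repset H -> w \in H ->
    x (wperm w t) = lact (wbase w (wperm w t)) (y t).
  have /fin_all_exists[x xE] : forall k, exists z : X, forall t w, t \in orbit_repset H ->
      w \in H -> wperm w t = k -> z = lact (wbase w k) (y t).
    move=> k; have [t tX [w wH wk]] := orbit_rep H k.
    exists (lact (wbase w k) (y t)) => t' w' tX' wH' wk'.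
    by rewrite -[in LHS]wk (repE _ t' _ w') ?wk ?wk'.
  by exists (finfun x) => t w tX wH; rewrite ffunE; apply: xE.
exists x; last first.
  by move=> t tX; have := xE t 1%g tX (group1 H); rewrite wperm1 perm1 wbase1 lact1.
apply/gfixP => w wH; apply/ffunP => k; rewrite ffunE.
have [t tX [v vH vk]] := orbit_rep H ((wperm w)^-1%g k).
rewrite -vk (xE t v tX vH) -lactM.
have kE : wperm (w * v)%g t = k by rewrite wpermM permM vk permKV.
rewrite -[in RHS]kE (xE t (w * v)%g tX) ?groupM //.
by rewrite wbaseM kE -vk.
Qed.

(** Restriction to orbit representatives is a bijection onto a product.  The values
    elsewhere are recorded as [None] so that this product is a family of finite
    sets even when X is empty. *)
Lemma card_gfix_pow X H :
  #|gfix (pow_gset n X) H| = (\prod_(t in orbit_repset H) #|gfix X (isotropy H t)|)%N.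
Proof.
pose F t : {set option X} :=
  if t \in orbit_repset H then [set Some u | u in gfix X (isotropy H t)] else [set None].
pose r (x : pow_gset n X) : {ffun 'I_n -> option X} :=
  [ffun t => if t \in orbit_repset H then Some (x t) else None].
have rI : {in gfix (pow_gset n X) H &, injective r}.
  move=> x x' xH xH' /ffunP E; apply/ffunP=> k.
  have [t tX [w wH <-]] := orbit_rep H k.
  rewrite (gfix_powE _ xH wH) (gfix_powE _ xH' wH); congr lact.
  by have := E t; rewrite !ffunE tX => -[].
rewrite -(card_in_imset rI).
transitivity #|family F|.
  apply: eq_card => y; apply/imsetP/familyP => [[x xH ->] t|yF].
    rewrite ffunE /F; case: ifP => // _; last exact: set11.
    by apply: imset_f; apply: gfix_pow_isotropy.
  have yR k : k \in orbit_repset H ->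
      exists2 u, u \in gfix X (isotropy H k) & y k = Some u.
    by move=> kR; have := yF k; rewrite /F kR => /imsetP[u uX ->]; exists u.
  have /fin_all_exists[z zE] : forall k, exists z : X, k \in orbit_repset H -> y k = Some z.
    move=> k; have [/yR[u _ ->]|_] := boolP (k \in orbit_repset H); first by exists u.
    by have [t /yR[u _ _] _] := orbit_rep H k; exists u.
  have [t tR|x xH xz] := @gfix_pow_extend X H z.
    by have [u uX] := yR t tR; rewrite zE // => -[->].
  exists x => //; apply/ffunP => k; rewrite ffunE; case: ifP => kR.
    by rewrite zE // xz.
  by have := yF k; rewrite /F kR => /set1P.
rewrite card_family foldrE big_map big_enum /= [RHS]big_mkcond; apply: eq_bigr => t _.
rewrite /F; case: ifP => _; last by rewrite cards1.
by rewrite card_imset // => u v [].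
Qed.

Lemma marks_pow X : marks (gclass (pow_gset n X)) = beta_star (marks_power n (marks (gclass X))).
Proof.
apply/ffunP => c; rewrite -(conj_reprK c); set H := conj_repr c.
rewrite marks_gclass card_gfix_pow beta_starE ffunE beta_partsE parts_eval_parts_of.
by rewrite natr_prod; apply: eq_bigr => t _; rewrite marks_gclass.
Qed.

(** The power of a transitive set is transitive: the base group alone moves any
    point to the diagonal one. *)
Lemma gclass_pow_coset (K : {group gT}) :
  exists L, gclass (pow_gset n (coset_gset K)) = basis (conj_of L).
Proof.
have [pt [_ ptE] _] := coset_reps K.
pose x0 : pow_gset n (coset_gset K) := [ffun=> pt].
exists ('C[x0 | gset_act (pow_gset n (coset_gset K))])%G.
rewrite (@gclass_reps _ _ [set x0]) ?big_set1 //.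
split=> [x y /set1P -> /set1P -> //|x]; exists x0; first exact: set11.
have /fin_all_exists[a aE] : forall k, exists a, lact a pt = x k.
  move=> k; have [p /set1P -> /orbit_gsetP[a <-]] := ptE (x k).
  by exists a^-1%g; rewrite -lactM mulVg lact1.
rewrite orbit_sym; apply/orbit_gsetP; exists (Wr (finfun a) 1%g).
by apply/ffunP => k; rewrite ffunE -aE /= !ffunE.
Qed.

End Powers.

(** * Virtual sets and coefficients of star products *)

(** An induction principle for virtual sets: sums reach effective elements, and
    the cancellation hypothesis then yields differences. *)
Lemma burnside_ind (gT : finGroupType) (Q : burnside gT -> Prop) :
  (forall c, Q (basis c)) -> (forall x y, Q x -> Q y -> Q (x + y)) ->
  (forall x y, Q (x + y) -> Q y -> Q x) -> forall x, Q x.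
Proof.
move=> Qb QD QB x.
have Q0 : Q 0 by apply: QB (Qb (conj_of 1%G)); rewrite add0r; apply: Qb.
have QN y : Q y -> Q (- y) by move=> Qy; apply: QB Qy; rewrite addNr.
have Qn y m : Q y -> Q (y *+ m).
  by move=> Qy; elim: m => [|m IH]; rewrite ?mulr0n // mulrS; apply: QD.
rewrite (burnside_sum x); apply: big_ind => // c _.
case: (x c) => m; first exact: Qn.
by rewrite NegzE mulrNz; apply/QN/Qn.
Qed.

Lemma basis_support (gT : finGroupType) (c d : Conj gT) : basis c d != 0 -> d = c.
Proof. by rewrite ffunE; case: (d =P c) => // _; rewrite eqxx. Qed.

Lemma gclass_point (gT : finGroupType) : gclass (point_gset gT) = basis (conj_of [set: gT]%G).
Proof.
rewrite (@gclass_reps _ (point_gset gT) [set tt]) ?big_set1; last first.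
  by split=> [[] []|[]] //; exists tt; rewrite ?orbit_refl ?inE.
by congr basis; apply: stab_classE => a; rewrite inE.
Qed.

Lemma gclass_ge0 (gT : finGroupType) (X : gset gT) c : 0 <= gclass X c.
Proof. by rewrite sum_ffunE sumr_ge0 // => x _; rewrite ffunE ler0n. Qed.

Section StarSupport.
Variables (gT : finGroupType) (i j n : nat) (e : (i + j)%N = n).
Implicit Types (x : burnside (wr gT i)) (y : burnside (wr gT j)).

Lemma star_coef x y k :
  star e x y k = \sum_c \sum_d (k == star_class e c d)%:R * (x c * y d).
Proof.
rewrite starE sum_ffunE; apply: eq_bigr => c _; rewrite sum_ffunE.
by apply: eq_bigr => d _; rewrite ffunMzE ffunE -mulrzr intz.
Qed.

Lemma star_ge0 x y k : (forall d, 0 <= x d) -> (forall d, 0 <= y d) -> 0 <= star e x y k.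
Proof.
move=> x0 y0; rewrite star_coef; apply: sumr_ge0 => c _; apply: sumr_ge0 => d _.
by rewrite mulr_ge0 ?ler0n // mulr_ge0.
Qed.

(** Nonnegative coefficients cannot cancel, so supports multiply. *)
Lemma star_neq0 x y c d : (forall d, 0 <= x d) -> (forall d, 0 <= y d) ->
  x c != 0 -> y d != 0 -> star e x y (star_class e c d) != 0.
Proof.
move=> x0 y0 xc yd; apply: lt0r_neq0; rewrite star_coef.
have F0 c' d' : 0 <= (star_class e c d == star_class e c' d')%:R * (x c' * y d').
  by rewrite mulr_ge0 ?ler0n // mulr_ge0.
rewrite (bigD1 c) // ltr_wpDr //; first by apply: sumr_ge0 => c' _; apply: sumr_ge0.
rewrite (bigD1 d) // ltr_wpDr //; first exact: sumr_ge0.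
by rewrite eqxx mul1r mulr_gt0 // lt_neqAle eq_sym ?xc ?yd ?x0 ?y0.
Qed.

Lemma star_support x y k : star e x y k != 0 ->
  exists c d, [/\ k = star_class e c d, x c != 0 & y d != 0].
Proof.
apply: contra_neqP => no; rewrite star_coef big1 // => c _; rewrite big1 // => d _.
have [E|] := eqVneq k (star_class e c d); last by rewrite mul0r.
have [->|xc] := eqVneq (x c) 0; first by rewrite mul0r mulr0.
have [->|yc] := eqVneq (y d) 0; first by rewrite !mulr0.
by case: no; exists c, d.
Qed.

End StarSupport.

(** The class of the point in degree 0 is a unit for the star product.  The target
    has the same index n as the left factor, so no transport is needed; j is 0
    by e. *)
Lemma star_point (gT : finGroupType) n j (e : (n + j)%N = n) (x : burnside (wr gT n)) :
  star e x (gclass (point_gset (wr gT j))) = x.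
Proof.
have phiE u v : block_morphism gT e (u, v) = u.
  have kE (k : 'I_n) : k = block_join e (inl k) by apply: val_inj.
  apply: wr_eqP => k; rewrite [in LHS](kE k).
    by rewrite wbase_blockl.
  by rewrite wperm_blockl -kE.
have clsE c : star_class e c (conj_of [set: wr gT j]%G) = c.
  transitivity (conj_of (block_morphism gT e @* setX (conj_repr c) [set: wr gT j])%G).
    by apply: conj_of_setX; rewrite ?conj_reprK.
  rewrite -[RHS]conj_reprK; congr conj_of; apply: val_inj; apply/setP => u /=.
  apply/imsetP/idP => [[[u' v] /setIP[_]]|uc].
    by rewrite inE => /andP[uc _] ->; rewrite phiE.
  by exists (u, 1%g); rewrite ?phiE // !inE uc.
rewrite starE gclass_point [RHS]burnside_sum; apply: eq_bigr => c _.
have bE d : basis (conj_of [set: wr gT j]%G) d = (d == conj_of [set: wr gT j]%G)%:R.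
  by rewrite ffunE.
rewrite (bigD1 (conj_of [set: wr gT j]%G)) // big1 => [|d cd].
  by rewrite bE eqxx mulr1 clsE; apply: addr0.
by rewrite bE (negPf cd) mulr0 mulr0z.
Qed.

(** * The summand spanned by the total power operations *)

Section Corollary.
Variables (gT : finGroupType) (P : forall m : nat, burnside gT -> burnside (wr gT m)).
Hypothesis P_power : total_power_operations P.
Implicit Types (x y : burnside gT).

Lemma power_gclass n X : P n (gclass X) = gclass (pow_gset n X).
Proof. by case: P_power. Qed.

Lemma power0 n x : n = 0%N -> P n x = gclass (point_gset (wr gT n)).
Proof. by move->; case: P_power. Qed.

Lemma powerD n x y :
  P n (x + y) = \sum_(i < n.+1) star (subnKC (leq_ord i)) (P i x) (P (n - i) y).
Proof. by case: P_power => _ _ ->. Qed.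

Lemma power_of_basis n c : P n (basis c) = gclass (pow_gset n (coset_gset (conj_repr c))).
Proof. by rewrite -power_gclass gclass_coset conj_reprK. Qed.

(** The n-th power of the empty set is empty for positive n. *)
Lemma power_zero n : (0 < n)%N -> P n 0 = 0.
Proof.
move=> n_gt0; pose V := @GSet gT void (fun _ v => v) (fun=> erefl) (fun _ _ _ => erefl).
have -> : 0 = gclass V by rewrite /gclass big1 // => -[].
by rewrite power_gclass /gclass big1 // => v; case: (v (Ordinal n_gt0)).
Qed.

Lemma power_effective_ge0 n s c : 0 <= P n (\sum_(d <- s) basis d) c.
Proof.
elim: s n c => [|d s IH] n c.
  rewrite big_nil; case: (posnP n) => [n0|/power_zero->]; last by rewrite ffunE.
  by rewrite power0 // gclass_ge0.
rewrite big_cons powerD sum_ffunE sumr_ge0 // => i _; apply: star_ge0 => // d'.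
by rewrite power_of_basis gclass_ge0.
Qed.

(** The classes occurring in powers of effective elements.  They turn out to be
    the smallest spanning subset ([power_basisP]); effectiveness is what makes
    their closure under the star product provable. *)
Definition power_orbit n (c : Conj (wr gT n)) :=
  exists s : seq (Conj gT), P n (\sum_(d <- s) basis d) c != 0.

(** If c occurs in P_i(x) and d in P_(n-i)(y), their product occurs in the i-th
    summand of P_n(x + y), and the other summands are nonnegative. *)
Lemma power_orbit_star n (i : 'I_n.+1) c d : power_orbit c -> power_orbit d ->
  power_orbit (star_class (subnKC (leq_ord i)) c d).
Proof.
move=> [s sc] [t td]; exists (s ++ t); rewrite big_cat powerD; apply: lt0r_neq0.
rewrite sum_ffunE (bigD1 i) //= ltr_wpDr //.
  by rewrite sumr_ge0 // => k _; apply: star_ge0 => *; apply: power_effective_ge0.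
rewrite lt_neqAle eq_sym star_neq0 ?star_ge0 //; by move=> *; apply: power_effective_ge0.
Qed.

Lemma star_support_orbit n (i : 'I_n.+1) (x : burnside (wr gT i))
    (y : burnside (wr gT (n - i))) c :
  (forall d, x d != 0 -> power_orbit d) -> (forall d, y d != 0 -> power_orbit d) ->
  star (subnKC (leq_ord i)) x y c != 0 -> power_orbit c.
Proof.
move=> xP yP /star_support[c1 [c2 [-> /xP ? /yP ?]]].
exact: power_orbit_star.
Qed.

(** For virtual x the support of P_n(x) is controlled by induction on n: in the
    formula for P_n(x + y) the last term is P_n(x) itself, and the earlier ones
    involve P_i(x) with i < n. *)
Lemma power_support x n c : P n x c != 0 -> power_orbit c.
Proof.
elim/burnside_ind: x n c => [d|x y IHx IHy|x y IHxy IHy] n c.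
- by exists [:: d]; rewrite big_seq1.
- rewrite powerD sum_ffunE => /eqP; apply: contra_notP => no.
  apply: big1 => i _; apply/eqP; apply: contra_notT no.
  by apply: star_support_orbit => d; [apply: IHx | apply: IHy].
elim/ltn_ind: n c => n IHn c; apply: contra_neqP => no.
have: P n (x + y) c = 0 by apply/eqP; apply: contra_notT no; apply: IHxy.
rewrite powerD sum_ffunE big_ord_recr /= big1 ?add0r => [|i _].
  by rewrite (@power0 (n - n)) ?subnn // star_point.
apply/eqP; apply: contra_notT no.
apply: (@star_support_orbit n (widen_ord (leqnSn n) i)); last exact: IHy.
by apply: IHn => /=.
Qed.

(** The classes [power_orbit] span the image of P_n and each is needed, since it
    has a nonzero coefficient in some power. *)
Lemma power_basisP n c : reflect (power_orbit c) (c \in power_basis P n).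
Proof.
apply: (iffP idP) => [/bigcapP cP|[s sc]].
  have /cP : `[< forall x, in_span [set c | `[< power_orbit c >]] (P n x) >].
    apply/asboolP => x; apply/in_spanP => d; rewrite inE => /asboolPn; apply: contra_notP.
    by move/eqP/power_support.
  by rewrite inE => /asboolP.
apply/bigcapP => S /asboolP PS.
by apply: contraNT sc => cS; apply/eqP; move/in_spanP: (PS (\sum_(d <- s) basis d)); apply.
Qed.

Lemma AringP n (x : burnside (wr gT n)) :
  (forall c, x c != 0 -> power_orbit c) -> x \in @Aring_pred gT P n.
Proof.
move=> xP; apply/asboolP/in_spanP => c; apply: contraNeq => xc.
by apply/power_basisP/xP.
Qed.

Lemma Aring_support n (x : Aring P n) c : val x c != 0 -> power_orbit c.
Proof.
move=> xc; apply/power_basisP; apply: contraNT xc => cP; apply/eqP.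
by have /asboolP/in_spanP -> := valP x.
Qed.

Fact Aring_star_subproof n (i : 'I_n.+1) (x : Aring P i) (y : Aring P (n - i)) :
  star (subnKC (leq_ord i)) (val x) (val y) \in @Aring_pred gT P n.
Proof.
apply: AringP => c; apply: star_support_orbit; exact: Aring_support.
Qed.
Definition Aring_star n (i : 'I_n.+1) (x : Aring P i) (y : Aring P (n - i)) : Aring P n :=
  Sub (star (subnKC (leq_ord i)) (val x) (val y)) (Aring_star_subproof x y).

(** * The two commuting squares *)

Variable chi : forall m : nat, {additive Aring P m -> Parks gT m}.
Hypothesis chi_parks : parks_homomorphism chi.

Lemma chi_star n (i : 'I_n.+1) (x : Aring P i) (y : Aring P (n - i)) :
  chi n (Aring_star x y) = parks_star (chi i x) (chi (n - i) y).
Proof. by case: chi_parks => _ chiM _; apply: (chiM _ _ _ (subnKC (leq_ord i))). Qed.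

Lemma chi_one n (z : Aring P n) : n = 0%N ->
  val z = gclass (point_gset (wr gT n)) -> chi n z = [ffun=> 1].
Proof. by move=> n0; subst n; case: chi_parks => chi1 _ _; apply: chi1. Qed.

Lemma chi_power_basis n c : chi n (Aring_power P n (basis c)) = marks_power n (marks (basis c)).
Proof.
rewrite -(conj_reprK c) -gclass_coset; apply/ffunP => l; rewrite [RHS]ffunE.
case: (posnP n) => [n0|n_gt0]; last by case: chi_parks => _ _ ->.
rewrite chi_one ?[val _]power0 // ffunE parts_eval_norm0 //.
by rewrite (eqP (parts_valP l)).
Qed.

Lemma Aring_powerD n x y : Aring_power P n (x + y) =
  \sum_(i < n.+1) Aring_star (Aring_power P i x) (Aring_power P (n - i) y).
Proof. by apply: val_inj; rewrite raddf_sum; apply: powerD. Qed.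

Lemma chi_powerD n x y : chi n (Aring_power P n (x + y)) =
  \sum_(i < n.+1) parks_star (chi i (Aring_power P i x))
                             (chi (n - i) (Aring_power P (n - i) y)).
Proof.
by rewrite Aring_powerD raddf_sum; apply: eq_bigr => i _; rewrite chi_star.
Qed.

(** Commutativity of the left square, by the recursion shared by both sides; the
    cancellation step is again an induction on n isolating the last term. *)
Lemma chi_power n x : chi n (Aring_power P n x) = marks_power n (marks x).
Proof.
elim/burnside_ind: x n => [c|x y IHx IHy|x y IHxy IHy] n; first exact: chi_power_basis.
  rewrite chi_powerD raddfD marks_powerD; apply: eq_bigr => i _.
  by rewrite IHx IHy.
elim/ltn_ind: n => n IHn.
have := IHxy n; rewrite chi_powerD raddfD marks_powerD !big_ord_recr /=.
rewrite (eq_bigr (fun i : 'I_n => parks_star (marks_power i (marks x))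
   (marks_power (n - i) (marks y)))) => [|i _]; last by rewrite IHn // IHy.
by move/addrI; rewrite IHy !parks_star_power0 ?subnn.
Qed.

(** A class occurring in P_n([G/K] + a), with a effective, is the star product of
    the single class P_i([G/K]), where [marks_pow] applies, and of a class
    occurring in P_(n-i)(a). *)
Lemma beta_star_chi_basis n c (y : Aring P n) : power_orbit c -> val y = basis c ->
  beta_star (chi n y) = marks (basis c).
Proof.
case=> s; elim: s n c y => [|d s IHs] n c y.
  rewrite big_nil; case: (posnP n) => [n0|/power_zero->]; last by rewrite ffunE eqxx.
  rewrite power0 // => cP yc.
  have cE : basis c = gclass (point_gset (wr gT n)).
    by move: cP; rewrite gclass_point => /basis_support ->.
  rewrite cE in yc *; rewrite (chi_one n0 yc); apply/ffunP => k; rewrite -(conj_reprK k).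
  rewrite beta_starE ffunE marks_gclass (_ : gfix _ _ = setT) ?cardsT ?card_unit //.
  by apply/setP => -[]; rewrite in_setT; apply/gfixP.
rewrite big_cons powerD sum_ffunE => cP yc.
have [i /star_support[c1 [c2 [cE c1P c2P]]]] :
  exists i : 'I_n.+1, star (subnKC (leq_ord i)) (P i (basis d))
     (P (n - i) (\sum_(d <- s) basis d)) c != 0.
  apply: contrapT => no; case/eqP: cP; apply: big1 => i _; apply/eqP.
  by apply: contra_notT no => ci; exists i.
have [L LE] := gclass_pow_coset i (conj_repr d).
have dE : P i (basis d) = basis c1.
  by move: c1P; rewrite power_of_basis LE => /basis_support ->.
have c2A : basis c2 \in @Aring_pred gT P (n - i).
  by apply: AringP => c' /basis_support ->; exists s.
pose y1 := Aring_power P i (basis d); pose y2 : Aring P (n - i) := Sub (basis c2) c2A.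
have bE : basis c = star (subnKC (leq_ord i)) (val y1) (val y2).
  rewrite -[val y1]/(P i (basis d)) dE -[val y2]/(basis c2) cE.
  exact/esym/star_basis_class.
have -> : y = Aring_star y1 y2 by apply: val_inj; rewrite yc bE.
rewrite chi_star bE; apply: beta_star_star; last exact: IHs.
by rewrite chi_power_basis [val _]power_of_basis marks_pow gclass_coset conj_reprK.
Qed.

Lemma beta_star_chi n (y : Aring P n) : beta_star (chi n y) = marks (val y).
Proof.
(* Outside the basis of the summand b c is the default 0, and y has coefficient 0. *)
pose b c : Aring P n := insubd 0 (basis c).
have bE c : power_orbit c -> val (b c) = basis c.
  by move=> cP; rewrite val_insubd AringP // => d /basis_support ->.
have yE : y = \sum_c b c *~ val y c.
  apply: val_inj; rewrite raddf_sum [LHS]burnside_sum; apply: eq_bigr => c _.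
  have [->|yc] := eqVneq (val y c) 0; first by rewrite !mulr0z.
  by rewrite -(bE c (Aring_support yc)) [RHS]raddfMz.
apply/ffunP => k; rewrite {1}yE raddf_sum ffunE sum_ffunE marksE.
apply: eq_bigr => c _; rewrite raddfMz ffunMzE.
have [->|/Aring_support cP] := eqVneq (val y c) 0; first by rewrite mulr0 mulr0z.
have := beta_star_chi_basis cP (bE c cP); move/ffunP/(_ k); rewrite ffunE => ->.
by rewrite -mulrzr intz.
Qed.

End Corollary.

Theorem corollary13p8
    (gT : finGroupType)
    (P : forall m : nat, burnside gT -> burnside (wr gT m))
    (P_power : total_power_operations P)
    (chi : forall m : nat, {additive Aring P m -> Parks gT m})
    (chi_parks : parks_homomorphism chi)
    (n : nat) :
  [/\ forall x : burnside gT,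
        chi n (Aring_power P n x) = marks_power n (marks x),
      forall y : Aring P n,
        beta_star (chi n y) = marks (val y)
    & forall (f : Marks gT) (H : {group wr gT n}),
        beta_star (marks_power n f) (conj_of H)
          = \prod_(k <- finsupp (parts_val (beta H)))
              f k.1 ^+ parts_val (beta H) k
        /\
        \prod_(k <- finsupp (parts_val (beta H)))
            f k.1 ^+ parts_val (beta H) k
          = \prod_(i in orbit_transversal (wr_idx gT n) H [set: 'I_n])
              f (conj_of (isotropy_group H i))].
Proof.
split=> [x|y|f H].
- exact: chi_power.
- exact: beta_star_chi.
split; first by rewrite beta_starE ffunE.
by rewrite -[LHS]/(parts_eval f (beta H)) beta_partsE parts_eval_parts_of.
Qed.
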